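(* Let $B$ be a finite connected CW left regular band with support map $\sigma\colon B\to\Lambda(B)$, $\sigma(b)=Bb$, and let $\mu$ be the Möbius function of $\Lambda(B)$. Then for $X\in\Lambda(B)$, $$|\sigma^{-1}(X)|=\sum_{Y\ge X}|\mu(X,Y)|.$$ In particular, the size of the minimal ideal of $B$ is $f_0(\Sigma(B))=\sum_{X\in\Lambda(B)}|\mu(\hat0,X)|$. More generally, $$f_k(\Sigma(B))=\sum_{\dim X=k,\ Y\ge X}|\mu(X,Y)|.$$
   Context: A left regular band is a finite semigroup $B$ with $x^2=x$, $xyx=xy$, ordered by $a\le b$ iff $ba=a$; $\Lambda(B)=\{Bb\}$ ordered by inclusion, with minimum $\hat0$; $B_{\ge X}=\{b\mid Bb\supseteq X\}$; $B$ is connected if each order complex $\Delta(B_{\ge X})$ is connected. A CW poset is a finite graded poset $P$ such that the realization of $\Delta(P_{<p})$ is a sphere of dimension $\dim\Delta(P_{\le p})-1$; $\Sigma(P)$ is the regular CW complex with closed cells the realizations of $\Delta(P_{\le p})$; $B$ is a CW left regular band if every $B_{\ge X}$ is a CW poset. For such $B$, $\Lambda(B)$ is graded and $\dim X$ denotes $\dim\Delta(\Lambda(B)_{\le X})$. $f_k(\Sigma(B))$ is the number of $k$-dimensional cells of $\Sigma(B)$. *)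

(* Defs.v *)
From HB Require Import structures.
From mathcomp Require Import all_boot all_order all_algebra.
From mathcomp Require Import all_classical all_reals all_analysis.

Set Implicit Arguments.
Unset Strict Implicit.
Unset Printing Implicit Defensive.

(* Orders every type [{set T}] by inclusion. *)
Import Order.DefaultSetSubsetOrder.
Import Order.TTheory GRing.Theory Num.Theory.
Import numFieldNormedType.Exports.

Local Open Scope ring_scope.

(* A finite simplicial complex on a finite vertex set [T] is given by its set
   of nonempty simplices. *)
Section Complexes.
Variables (R : realType) (T : finType).
Implicit Types (K : {set {set T}}) (C D : {set T}).

(* Meant for nonempty complexes: the truncated predecessor makes the dimension
   of the empty complex 0 rather than -1. *)
Definition dim K : nat := (\max_(C in K) #|C|).-1.

Definition facet K C : bool := maxset (mem K) C.

Definition pure K : Prop := forall C D, facet K C -> facet K D -> #|C| = #|D|.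

(* Barycentric coordinates, the vertex [t] being the basis vector of index
   [enum_rank t]. *)
Definition realization K : set 'rV[R]_#|T| :=
  [set x | [/\ forall i, 0 <= x ord0 i,
               \sum_i x ord0 i = 1
             & [set t | x ord0 (enum_rank t) != 0]%SET \in K]]%classic.

End Complexes.

Arguments realization R {T} K.

(* The unit sphere of R^n for the Euclidean norm, of dimension n - 1; it is
   empty for n = 0, as a sphere of dimension -1 should be. *)
Definition unit_sphere (R : realType) (n : nat) : set 'rV[R]_n :=
  [set x | \sum_i x ord0 i ^+ 2 = 1]%classic.

Arguments unit_sphere R n : clear implicits.

Definition homeomorphic (U V : topologicalType) (A : set U) (B : set V) : Prop :=
  exists f : U -> V, exists g : V -> U,
    [/\ {within A, continuous f}%classic, {within B, continuous g}%classic,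
        forall x, A x -> B (f x) /\ g (f x) = x
      & forall y, B y -> A (g y) /\ f (g y) = y].

Section Posets.
Variables (d : Order.disp_t) (T : finPOrderType d).
Implicit Types (P : {set T}) (p x y : T).

Definition is_chain (C : {set T}) : bool :=
  [forall x in C, forall y in C, (x >=< y)%O].

Definition order_complex P : {set {set T}} :=
  [set C : {set T} | [&& C \subset P, is_chain C & C != finset.set0]]%SET.

Definition lower P p : {set T} := [set x in P | (x <= p)%O]%SET.
Definition strict_lower P p : {set T} := [set x in P | (x < p)%O]%SET.

Definition graded P : Prop := forall p, p \in P -> pure (order_complex (lower P p)).

(* [unit_sphere R n] has dimension n - 1. *)
Definition CW_poset (R : realType) P : Prop :=
  graded P /\
  forall p, p \in P ->
    homeomorphic (realization R (order_complex (strict_lower P p)))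
                 (unit_sphere R (dim (order_complex (lower P p)))).

(* The closed cells of Sigma(P), each given by its triangulation. *)
Definition Sigma P : {set {set {set T}}} :=
  [set order_complex (lower P p) | p in P]%SET.

Definition f_vector P (k : nat) : nat := #|[set c in Sigma P | dim c == k]%SET|.

(* The Moebius function of the subposet [P]: the fuel #|P| always suffices, see
   [mobiusE] below. *)
Fixpoint mobius_rec (n : nat) P x y : int :=
  if n is n'.+1 then
    if x == y then 1
    else - \sum_(z in P | (x <= z < y)%O) mobius_rec n' P x z
  else 0.

Definition mobius P x y : int := mobius_rec #|P| P x y.

Lemma mobius_recE P n x y : x \in P -> y \in P ->
  (#|[set z in P | (x <= z <= y)%O]%SET| <= n)%N ->
  mobius_rec n P x y = mobius_rec n.+1 P x y.
Proof.
move=> xP; elim: n y => [|n IH] y yP.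
  rewrite leqn0 cards_eq0 => /eqP I0 /=.
  have -> : (x == y) = false.
    apply/eqP => exy; have : y \in finset.set0 by rewrite -I0 inE yP exy lexx.
    by rewrite inE.
  by rewrite big1 ?oppr0.
move=> Hn; rewrite [LHS]/= [RHS]/=; case: eqP => // _; congr (- _).
apply: eq_bigr => z /andP[zP /andP[xz zy]].
apply: IH => //; rewrite -ltnS; apply: leq_trans Hn; apply: proper_card.
apply/properP; split.
  apply/fintype.subsetP => w; rewrite !inE => /andP[-> /andP[-> wz]].
  exact: le_trans wz (ltW zy).
exists y; first by rewrite inE yP lexx (le_trans xz (ltW zy)).
by rewrite inE yP /= (lt_geF zy) andbF.
Qed.

Lemma mobiusE P x y : x \in P -> y \in P ->
  mobius P x y =
    if x == y then 1 else - \sum_(z in P | (x <= z < y)%O) mobius P x z.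
Proof.
move=> xP yP; rewrite /mobius mobius_recE //.
by apply: subset_leq_card; apply/fintype.subsetP => z; rewrite inE => /andP[].
Qed.

End Posets.

(* The underlying order is the one attached to the band, a <= b iff ba = a; that
   this relation is a partial order follows from the other axioms. *)
HB.mixin Record isLRB d T of Order.FinPOrder d T & Semigroup T := {
  lrb_nonempty : inhabited T;
  lrb_idem : forall x : T, (x * x)%g = x;
  lrb_regular : forall x y : T, (x * y * x)%g = (x * y)%g;
  lrb_leE : forall a b : T, (a <= b)%O = ((b * a)%g == a)
}.

#[short(type="lrbType")]
HB.structure Definition LRB d := {T of isLRB d T & Order.FinPOrder d T & Semigroup T}.

Section LRB.
Variables (d : Order.disp_t) (B : lrbType d).
Implicit Types (a b : B) (X Y : {set B}).

Definition supp b : {set B} := [set (c * b)%g | c in B]%SET.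

Definition Lambda : {set {set B}} := [set supp b | b : B]%SET.

Definition upper X : {set B} := [set b : B | (X <= supp b)%O]%SET.

Definition hat0 : {set B} := (\meet_(X in Lambda) X)%O.

Definition dim_supp X : nat := dim (order_complex (lower Lambda X)).

Definition connected_lrb (R : realType) : Prop :=
  forall X, X \in Lambda -> connected (realization R (order_complex (upper X))).

Definition CW_lrb (R : realType) : Prop :=
  forall X, X \in Lambda -> CW_poset R (upper X).

Definition is_ideal (I : {set B}) : bool :=
  (I != finset.set0) &&
  [forall a, forall b, (a \in I) ==> ((a * b)%g \in I) && ((b * a)%g \in I)].

Definition minimal_ideal : {set B} := (\bigcap_(I : {set B} | is_ideal I) I)%SET.

Lemma mem_supp a b : (a \in supp b) = ((a * b)%g == a).
Proof.
apply/imsetP/eqP => [[c _ ->]|<-]; last by exists a.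
by rewrite -mulgA lrb_idem.
Qed.

Lemma suppM a b : supp (a * b)%g = (supp a `&` supp b)%O.
Proof.
apply/setP => c; rewrite finset.in_setI !mem_supp.
apply/eqP/andP => [cab|[/eqP ca /eqP cb]]; last by rewrite mulgA ca cb.
split; apply/eqP.
  by rewrite -{1}cab -mulgA lrb_regular cab.
by rewrite -{1}cab -!mulgA lrb_idem cab.
Qed.

Lemma hat0P : hat0 \in Lambda /\ forall X, X \in Lambda -> (hat0 <= X)%O.
Proof.
split; last by move=> X XL; apply: meets_inf.
have [b0] := @lrb_nonempty d B.
have L0 : supp b0 \in Lambda by apply: imset_f.
suff [b] : exists b, (supp b0 `&` hat0)%O = supp b.
  have -> : (supp b0 `&` hat0)%O = hat0 by apply/meet_idPr; apply: meets_inf.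
  by move=> ->; apply: imset_f.
rewrite /hat0; elim/big_rec: _ => [|X Y /imsetP[a _ ->] [b IH]].
  by exists b0; rewrite meetx1.
by exists (a * b)%g; rewrite meetCA IH suppM.
Qed.

Lemma minimal_idealP : minset is_ideal minimal_ideal.
Proof.
have idealP (I : {set B}) : reflect (I != finset.set0 /\ forall a b, a \in I ->
    (a * b)%g \in I /\ (b * a)%g \in I) (is_ideal I).
  apply: (iffP andP) => -[I0 H]; split => //.
    by move=> a b aI; move/forallP/(_ a)/forallP/(_ b): H; rewrite aI => /andP[].
  by apply/forallP => a; apply/forallP => b; apply/implyP => /(H _ b)[-> ->].
have /imsetP[e _ he] := hat0P.1.
have eI (I : {set B}) : is_ideal I -> e \in I.
  move=> /idealP[/set0Pn[a aI] H].
  have /fintype.subsetP/(_ e) : supp e \subset supp a.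
    by rewrite -[X in is_true X]/(supp e <= supp a)%O -he hat0P.2 //; apply: imset_f.
  rewrite !mem_supp lrb_idem eqxx => /(_ isT)/eqP <-.
  by have [] := H a e aI.
apply/minsetP; split; last first.
  by move=> J JI sJ; apply/eqP; rewrite finset.eqEsubset sJ; apply: finset.bigcap_inf.
apply/idealP; split.
  by apply/set0Pn; exists e; apply/bigcapP => I /eI.
by move=> a b /bigcapP aI; split; apply/bigcapP => I II;
   have /idealP[_ /(_ a b (aI _ II))[]] := II.
Qed.

End LRB.

(* Main.v *)
(** Over the integers, the algebra of the band [upper X] always has a right unit
    [e], and connectedness of every [upper Z] makes [e] a left unit.  Comparing
    coefficients, [e] sums to 1 over [upper X] and over each of its principal
    filters, so that [upper X] has Euler characteristic 1, as each closed cell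
    has.  Writing [r] for the rank in [Lambda], this reads
    [\sum_(Y >= X) (-1)^(r Y - r X) |supp^-1 Y| = 1], and Moebius inversion gives
    [|supp^-1 X| = \sum_(Y >= X) (-1)^(r Y - r X) mu(X, Y)].  The same inversion
    inside one closed cell, with top of support [Y], exhibits
    [(-1)^(r Y - r X) mu(X, Y)] as the trace of an idempotent, hence as a
    nonnegative number.

    The topological input is that a finite complex homeomorphic to a sphere has
    the Euler characteristic of that sphere.  It is obtained from reduced
    Alexander-Spanier cohomology, in which cochains are arbitrary functions on
    small lists of points: invariance under homeomorphisms of compact spaces is
    uniform continuity, and attaching a cell along a sphere changes the Euler
    characteristic by one, by Mayer-Vietoris. *)

Require Import Defs.
From HB Require Import structures.
From mathcomp Require Import all_boot all_order all_algebra.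
From mathcomp Require Import all_classical all_reals all_analysis.
From mathcomp Require Import zify ring lra.
Import Order.DefaultSetSubsetOrder.
Import Order.TTheory GRing.Theory Num.Theory.
Import numFieldNormedType.Exports.

Set Implicit Arguments.
Unset Strict Implicit.
Unset Printing Implicit Defensive.

Local Open Scope ring_scope.

(** * Dimension of a quotient of vector spaces *)

Section QuotientDimension.
Variables (F : fieldType) (V : lmodType F).
Implicit Types (Z B K : V -> Prop).

(** Elements of the band algebra are handled through test functions: a right unit is the identity
    [\sum_y e y * g (x * y) = g x] for all [g]. A constant [g] gives total sum 1; the left-unit
    identity with the indicator of [c] gives the sum over the principal filter, because [y * c = c]
    means [c <= y]. The obstruction to [e] being a left unit is a function killed by left
    multiplication by [e]; it reduces to one that is constant on some [upper (supp b)] and zero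
    elsewhere, which is where connectedness acts. The idempotent of a cell is [b] minus the right
    unit of the elements strictly below [b], acting by matrices. On the topological side, cochains
    are arbitrary functions, so discontinuous maps are allowed as long as they move points little;
    this replaces subdivision. Cochain spaces being infinite-dimensional, finiteness of cohomology
    cannot be presupposed: a dimension is an explicit basis of cocycles modulo coboundaries, rebuilt
    at each attachment. *)

Definition subspace Z := Z 0 /\ forall a u v, Z u -> Z v -> Z (a *: u + v).

Lemma subspaceZ Z a u : subspace Z -> Z u -> Z (a *: u).
Proof. by case=> Z0 ZL Zu; rewrite -[_ *: _]addr0; apply: ZL. Qed.

Lemma subspaceD Z u v : subspace Z -> Z u -> Z v -> Z (u + v).
Proof. by case=> Z0 ZL Zu Zv; rewrite -[u]scale1r; apply: ZL. Qed.

Lemma subspaceN Z u : subspace Z -> Z u -> Z (- u).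
Proof. by move=> sZ Zu; rewrite -scaleN1r; apply: subspaceZ. Qed.

Lemma subspaceB Z u v : subspace Z -> Z u -> Z v -> Z (u - v).
Proof. by move=> sZ Zu Zv; apply: subspaceD => //; apply: subspaceN. Qed.

Lemma subspace_sum Z (I : Type) (r : seq I) (P : pred I) (c : I -> F) e :
  subspace Z -> (forall i, P i -> Z (e i)) -> Z (\sum_(i <- r | P i) c i *: e i).
Proof.
move=> sZ Ze; apply: (big_ind Z) => //; first exact: sZ.1.
  by move=> u v; apply: subspaceD.
by move=> i Pi; apply: subspaceZ => //; apply: Ze.
Qed.

(** The dimension of [Z / B], through representatives of a basis; finiteness is part of the
    statement. *)
Definition quot_dim Z B n := exists e : 'I_n -> V,
  [/\ forall i, Z (e i),
      forall v, Z v -> exists c : 'I_n -> F, B (v - \sum_i c i *: e i)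
    & forall c : 'I_n -> F, B (\sum_i c i *: e i) -> forall i, c i = 0].

(** Modulo [B], the first basis expands in the second by an [m] by [n] matrix; if [n < m], a nonzero
    row of its left kernel contradicts freeness. *)
Lemma quot_dim_leq Z B m n : subspace B ->
  quot_dim Z B m -> quot_dim Z B n -> (m <= n)%N.
Proof.
move=> sB [e [Ze _ free_e]] [f [_ span_f _]].
have [M MP] := choice (fun i => span_f _ (Ze i)).
rewrite leqNgt; apply/negP => lt_nm.
pose A := \matrix_(i < m, j < n) M i j.
have : kermx A != 0.
  rewrite -mxrank_eq0 mxrank_ker -lt0n subn_gt0.
  exact: leq_ltn_trans (rank_leq_col A) lt_nm.
case/rowV0Pn => u /sub_kermxP uA /negP; apply.
apply/eqP/rowP => i; rewrite mxE.
apply: (free_e (fun i => u ord0 i)).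
have -> : \sum_i u ord0 i *: e i =
    \sum_i u ord0 i *: (e i - \sum_j M i j *: f j).
  under [RHS]eq_bigr do rewrite scalerBr scaler_sumr.
  rewrite sumrB exchange_big /= [X in _ - X]big1 ?subr0 // => j _.
  under eq_bigr do rewrite scalerA.
  rewrite -scaler_suml.
  have := congr1 (fun X : 'rV_n => X ord0 j) uA.
  by rewrite !mxE => + ; under eq_bigr do rewrite mxE; move=> ->; rewrite scale0r.
by apply: subspace_sum => // i _; apply: MP.
Qed.

Lemma quot_dim_inj Z B m n : subspace B ->
  quot_dim Z B m -> quot_dim Z B n -> m = n.
Proof.
by move=> sB Dm Dn; apply/eqP; rewrite eqn_leq (quot_dim_leq sB Dm Dn) (quot_dim_leq sB Dn Dm).
Qed.

Lemma quot_dim0 Z B : (forall v, Z v -> B v) -> quot_dim Z B 0.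
Proof.
move=> ZB; exists (fun=> 0); split; first by case.
  by move=> v Zv; exists (fun=> 0); rewrite big_ord0 subr0; apply: ZB.
by move=> c _ [].
Qed.

Lemma quot_dim0P Z B v : quot_dim Z B 0 -> Z v -> B v.
Proof. by case=> e [_ span _] /span[c]; rewrite big_ord0 subr0. Qed.

(** Some basis vector [e i0] lies outside the hyperplane [K]; subtracting multiples of it pushes the
    others into [K], where they form a basis. *)
Lemma quot_dim_hyperplane Z B K n (z : V) :
  subspace B -> subspace K -> (forall v, B v -> K v) -> (forall v, K v -> Z v) ->
  subspace Z -> Z z -> ~ K z ->
  (forall v, Z v -> exists a, K (v - a *: z)) ->
  quot_dim Z B n -> exists2 m, n = m.+1 & quot_dim K B m.
Proof.
move=> sB sK BK KZ sZ Zz nKz HZ [e [Ze span free]].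
have [i0 nKe] : exists i, ~ K (e i).
  apply: contrapT => nK; apply: nKz.
  have [c Bc] := span _ Zz.
  rewrite -[z](subrK (\sum_i c i *: e i)); apply: subspaceD => //; first exact: BK.
  by apply: subspace_sum => // i _; apply: contrapT => nKi; apply: nK; exists i.
case: n e Ze span free i0 nKe => [|m] e Ze span free i0 nKe; first by case: i0 nKe.
exists m => //.
have [a0 Ka0] := HZ _ (Ze i0).
have a0N0 : a0 != 0.
  by apply: contra_notN nKe => /eqP a00; move: Ka0; rewrite a00 scale0r subr0.
have red v : Z v -> exists a, K (v - a *: e i0).
  move=> Zv; have [a Ka] := HZ _ Zv; exists (a / a0).
  have -> : v - (a / a0) *: e i0 = (v - a *: z) - (a / a0) *: (e i0 - a0 *: z).
    by rewrite scalerBr scalerA divfK // opprB addrA subrK.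
  by apply: subspaceB => //; apply: subspaceZ.
have [l Kl] := choice (fun i => red _ (Ze i)).
have sumE (c : 'I_m -> F) :
    \sum_j c j *: (e (lift i0 j) - l (lift i0 j) *: e i0) =
    \sum_j c j *: e (lift i0 j) - (\sum_j c j * l (lift i0 j)) *: e i0.
  under eq_bigr do rewrite scalerBr scalerA.
  by rewrite sumrB -scaler_suml.
exists (fun j => e (lift i0 j) - l (lift i0 j) *: e i0); split => [j|v Kv|c Bc j].
- exact: Kl.
- have [c Bc] := span _ (KZ _ Kv).
  have Kc : K (\sum_i c i *: e i).
    by rewrite -[\sum_i _](subKr v); apply: subspaceB => //; apply: BK.
  exists (fun j => c (lift i0 j)).
  suff <- : \sum_i c i *: e i =
     \sum_j c (lift i0 j) *: (e (lift i0 j) - l (lift i0 j) *: e i0) by [].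
  (* Otherwise [e i0] would be a combination of elements of [K]. *)
  have N0 : c i0 + \sum_j c (lift i0 j) * l (lift i0 j) = 0.
    apply/eqP/negPn/negP => N0; apply: nKe.
    rewrite -[e i0]scale1r -(mulVf N0) -scalerA; apply: subspaceZ => //.
    have -> : (c i0 + \sum_(i < m) c (lift i0 i) * l (lift i0 i)) *: e i0 =
       \sum_i c i *: e i - \sum_j c (lift i0 j) *: (e (lift i0 j) - l (lift i0 j) *: e i0).
      by rewrite (bigD1_ord i0) //= sumE opprB addrACA subrr addr0 scalerDl.
    by apply: subspaceB => //; apply: subspace_sum.
  rewrite (bigD1_ord i0) //= sumE addrC; congr (_ + _).
  by rewrite -scaleNr; congr (_ *: _); apply/eqP; rewrite -addr_eq0 N0.
pose d i := if unlift i0 i is Some j then c j else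
  - \sum_j c j * l (lift i0 j).
have := free d; rewrite (bigD1_ord i0) //= /d unlift_none.
under eq_bigr do rewrite liftK.
move=> /(_ _ (lift i0 j)); rewrite liftK; apply.
by move: Bc; rewrite sumE addrC scaleNr.
Qed.

End QuotientDimension.

(** * Cochains on lists of points *)

Section Cochains.
Variables (F : fieldType).
Implicit Types (U V : Type).

(* Cochains are arbitrary functions on lists of points; the empty list is the
   simplex of dimension -1, so the cohomology is reduced. *)
Fixpoint cobd U (s : seq U) (f : seq U -> F^o) : F^o :=
  if s is x :: s' then f s' - cobd s' (fun t => f (x :: t)) else 0.

Lemma cobd_linear U (s : seq U) : linear (@cobd U s).
Proof.
elim: s => [|x s IH] a f g /=; first by rewrite scaler0 addr0.
have -> : (fun t => (a *: f + g) (x :: t)) =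
  a *: (fun t => f (x :: t)) + (fun t => g (x :: t)) by [].
by rewrite IH /= scalerBr opprD addrACA.
Qed.

HB.instance Definition _ U (s : seq U) :=
  GRing.isLinear.Build F (seq U -> F^o) F^o _ (@cobd U s) (@cobd_linear U s).

Lemma cobdK U (s : seq U) f : cobd s (fun t => cobd t f) = 0.
Proof.
elim: s f => [//|x s IH] f /=.
have -> : (fun t => f t - cobd t (fun u => f (x :: u))) =
  f - (fun t => cobd t (fun u => f (x :: u))) by [].
by rewrite linearB /= IH subr0 subrr.
Qed.

Lemma eq_cobd (U : eqType) (s : seq U) f g :
  (forall t, {subset t <= s} -> size s = (size t).+1 -> f t = g t) ->
  cobd s f = cobd s g.
Proof.
elim: s f g => [//|x s IH] f g fg /=.
rewrite fg //; last by move=> y ys; rewrite inE ys orbT.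
congr (_ - _); apply: IH => t ts st; apply: fg => [y|]; last by rewrite /= st.
by rewrite !inE => /orP[->//|/ts->]; rewrite orbT.
Qed.

Lemma cobd_map U V (h : U -> V) (s : seq U) f :
  cobd (map h s) f = cobd s (f \o map h).
Proof. by elim: s f => [//|x s IH] f /=; rewrite IH. Qed.

(* The prism operator: f x_0, ..., f x_i, g x_i, ..., g x_k with alternating
   signs. *)
Fixpoint prism U V (f g : U -> V) (s : seq U) (phi : seq V -> F^o) : F^o :=
  if s is x :: s' then
    phi (f x :: map g s) - prism f g s' (fun t => phi (f x :: t))
  else 0.

Lemma prism_linear U V (f g : U -> V) s : linear (prism f g s).
Proof.
elim: s => [|x s IH] a u v /=; first by rewrite scaler0 addr0.
have -> : (fun t => (a *: u + v) (f x :: t)) =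
  a *: (fun t => u (f x :: t)) + (fun t => v (f x :: t)) by [].
by rewrite IH /= scalerBr opprD addrACA.
Qed.

HB.instance Definition _ U V f g s :=
  GRing.isLinear.Build F (seq V -> F^o) F^o _ (@prism U V f g s) (@prism_linear U V f g s).

(** The chain homotopy formula holds for arbitrary maps; closeness of [f] and [g] enters later, when
    the second term vanishes because its lists are small. *)
Lemma prism_homotopy U V (f g : U -> V) s phi :
  phi (map g s) - phi (map f s) =
  cobd s (fun t => prism f g t phi) + prism f g s (fun t => cobd t phi).
Proof.
elim: s phi => [|x s IH] phi /=; first by rewrite subrr addr0.
have -> : (fun t => phi (f x :: g x :: map g t)
                    - prism f g t (fun u => phi (f x :: u))) =
  ((fun t => phi (f x :: g x :: t)) \o map g)
    - (fun t => prism f g t (fun u => phi (f x :: u))) by [].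
have -> : (fun t => phi t - cobd t (fun u => phi (f x :: u))) =
  phi - (fun t => cobd t (fun u => phi (f x :: u))) by [].
have := IH (fun t => phi (f x :: t)).
rewrite !linearB /= cobd_map => H.
have ringE (b q r c u v p : F) : q - r = u + v ->
    b - r = p + (- c - - u) + (b + (- q - - c) + (- p - - v)).
  move=> E; have -> : r = q - (u + v) by rewrite -E subKr.
  ring.
exact: ringE H.
Qed.

Lemma prism_eq0 (U V : eqType) (f g : U -> V) s phi :
  (forall t, {subset t <= map f s ++ map g s} -> size t = (size s).+1 -> phi t = 0) ->
  prism f g s phi = 0.
Proof.
elim: s phi => [//|x s IH] phi phi0 /=; rewrite phi0 ?sub0r; last by rewrite /= size_map.
  rewrite IH ?oppr0 // => t ts st; apply: phi0; last by rewrite /= st.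
  move=> y; rewrite !inE => /orP[->//|/ts]; rewrite !mem_cat /= inE => /orP[]->; by rewrite ?orbT.
by move=> y; rewrite /= !inE mem_cat inE => /orP[->//|/orP[]->]; rewrite ?orbT.
Qed.

End Cochains.

(** * Alexander-Spanier cohomology *)

Section AlexanderSpanier.
Variables (R : realType) (F : fieldType).

Definition small (U : pseudoMetricType R) (X : set U) (eps : R) (s : seq U) :=
  {in s, forall x, X x} /\ {in s &, forall x y, ball x eps y}.

Section Space.
Variable (U : pseudoMetricType R).
Implicit Types (X Y A B : set U) (f g : seq U -> F^o) (p : bool).

(* The grading is only by the parity of the length of the lists, which is all
   that Euler characteristics need; [p = false] contains degree -1. *)
Definition cocycle X p f := exists2 eps : R, 0 < eps &
  forall s, small X eps s -> odd (size s) = ~~ p -> cobd s f = 0.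

Definition primitive X p f g := exists2 eps : R, 0 < eps &
  forall s, small X eps s -> odd (size s) = p -> f s = cobd s g.

Definition coboundary X p f := exists g, primitive X p f g.

Definition coh_dim X p n := quot_dim (cocycle X p) (coboundary X p) n.

Definition acyclic X := forall p f, cocycle X p f -> coboundary X p f.

Lemma small_sub X eps s t : {subset t <= s} -> small X eps s -> small X eps t.
Proof.
move=> ts [Xs bs]; split=> [x /ts/Xs//|x y /ts xs /ts ys]; exact: bs.
Qed.

Lemma small_le X e1 e2 s : e1 <= e2 -> small X e1 s -> small X e2 s.
Proof.
move=> le12 [Xs bs]; split=> // x y xs ys.
exact: le_ball le12 _ (bs _ _ xs ys).
Qed.

Lemma small_subset X Y eps s : (forall x, X x -> Y x) ->
  small X eps s -> small Y eps s.
Proof. by move=> XY [Xs bs]; split=> // x /Xs/XY. Qed.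

Lemma cocycle_subspace X p : subspace (cocycle X p).
Proof.
split; first by exists 1 => // s _ _; rewrite linear0.
move=> a f g [e1 e1_gt0 f1] [e2 e2_gt0 g2]; exists (Num.min e1 e2).
  by rewrite lt_min e1_gt0.
move=> s sm os; rewrite linearP /= f1 ?g2 ?scaler0 ?addr0 //.
  by apply: small_le sm; rewrite ge_min lexx orbT.
by apply: small_le sm; rewrite ge_min lexx.
Qed.

Lemma coboundary_subspace X p : subspace (coboundary X p).
Proof.
split; first by exists 0, 1 => // s _ _; rewrite linear0.
move=> a f g [h1 [e1 e1_gt0 f1]] [h2 [e2 e2_gt0 g2]].
exists (a *: h1 + h2), (Num.min e1 e2); first by rewrite lt_min e1_gt0.
move=> s sm os; rewrite linearP /= -f1 -?g2 //.
  by apply: small_le sm; rewrite ge_min lexx orbT.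
by apply: small_le sm; rewrite ge_min lexx.
Qed.

Lemma coboundary_cocycle X p f : coboundary X p f -> cocycle X p f.
Proof.
case=> g [eps e0 fE]; exists eps => // s sm os.
rewrite -(cobdK s g); apply: eq_cobd => t ts st; apply: fE.
  exact: small_sub sm.
by apply: negb_inj; rewrite -os st.
Qed.

Lemma coboundary_ext X p f g (eps : R) : 0 < eps ->
  (forall s, small X eps s -> odd (size s) = p -> f s = g s) ->
  coboundary X p f -> coboundary X p g.
Proof.
move=> e0 fg [h [e' e'0 fE]]; exists h, (Num.min eps e').
  by rewrite lt_min e0.
move=> s sm os; rewrite -fg ?fE //.
  by apply: small_le sm; rewrite ge_min lexx orbT.
by apply: small_le sm; rewrite ge_min lexx.
Qed.

Lemma cocycle_subset X Y p f : (forall x, X x -> Y x) ->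
  cocycle Y p f -> cocycle X p f.
Proof.
by move=> XY [e e0 fE]; exists e => // s /(small_subset XY); apply: fE.
Qed.

Lemma coboundary_subset X Y p f : (forall x, X x -> Y x) ->
  coboundary Y p f -> coboundary X p f.
Proof.
by move=> XY [h [e e0 fE]]; exists h, e => // s /(small_subset XY); apply: fE.
Qed.

Lemma coh_dim_inj X p m n : coh_dim X p m -> coh_dim X p n -> m = n.
Proof. exact: quot_dim_inj (coboundary_subspace X p). Qed.

Lemma acyclic_dim X p : acyclic X -> coh_dim X p 0.
Proof. by move=> aX; apply: quot_dim0; apply: aX. Qed.

End Space.

(** Uniform continuity, since one radius for small lists in [Y] must pull back to one radius in
    [X]. *)
Definition unif_map (U V : pseudoMetricType R) (X : set U) (Y : set V) (h : U -> V) :=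
  (forall x, X x -> Y (h x)) /\
  forall eps : R, 0 < eps -> exists2 dlt : R, 0 < dlt &
    forall x y, X x -> X y -> ball x dlt y -> ball (h x) eps (h y).

Section Maps.
Variables (U V : pseudoMetricType R) (X : set U) (Y : set V).
Implicit Types (f : seq V -> F^o).

Lemma unif_map_small h (eps : R) : unif_map X Y h -> 0 < eps ->
  exists2 dlt : R, 0 < dlt & forall s, small X dlt s -> small Y eps (map h s).
Proof.
move=> [XY uh] /uh[dlt d0 H]; exists dlt => // s [Xs bs]; split.
  by move=> _ /mapP[x xs ->]; apply/XY/Xs.
move=> _ _ /mapP[x xs ->] /mapP[y ys ->].
by apply: H; [exact: Xs|exact: Xs|exact: bs].
Qed.

Lemma cocycle_pull h p f : unif_map X Y h ->
  cocycle Y p f -> cocycle X p (f \o map h).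
Proof.
move=> uh [eps e0 fE]; have [dlt d0 H] := unif_map_small uh e0.
by exists dlt => // s /H sm os; rewrite -cobd_map fE ?size_map.
Qed.

Lemma coboundary_pull h p f : unif_map X Y h ->
  coboundary Y p f -> coboundary X p (f \o map h).
Proof.
move=> uh [g [eps e0 fE]]; have [dlt d0 H] := unif_map_small uh e0.
by exists (g \o map h), dlt => // s /H sm os; rewrite -cobd_map /= fE ?size_map.
Qed.

Lemma close_pull (h k : U -> V) p f (eps dlt : R) : 0 < dlt ->
  (forall s, small Y eps s -> odd (size s) = ~~ p -> cobd s f = 0) ->
  (forall s, small X dlt s -> small Y eps (map h s ++ map k s)) ->
  forall s, small X dlt s -> odd (size s) = p ->
    f (map k s) - f (map h s) = cobd s (fun t => prism h k t f).
Proof.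
move=> d0 fE hk s sm os; rewrite prism_homotopy.
rewrite [X in _ + X]prism_eq0 ?addr0 // => t ts st.
apply: fE; first by apply: small_sub ts _; apply: hk.
by rewrite st /= os.
Qed.

End Maps.

Lemma coh_dim_homeo (U V : pseudoMetricType R) (X : set U) (Y : set V) h k p n :
  unif_map X Y h -> unif_map Y X k ->
  (forall x, X x -> k (h x) = x) -> (forall y, Y y -> h (k y) = y) ->
  coh_dim Y p n -> coh_dim X p n.
Proof.
move=> uh uk kh hk [e [Ze span free]].
exists (fun i => e i \o map h); split => [i|v Zv|c Bc].
- exact: cocycle_pull uh (Ze i).
- have [c Bc] := span _ (cocycle_pull uk Zv); exists c.
  (* [k \o h] is the identity only on [X], so the cochains agree on lists in [X]; the radius 1 is
     arbitrary. *)
  apply: coboundary_ext (coboundary_pull uh Bc); first exact: ltr01.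
  move=> s [Xs _] _ /=; rewrite !fctE /= !fct_sumE /=; congr (v _ + _).
  rewrite -map_comp -[RHS]map_id; by apply/eq_in_map => x xs /=; exact/kh/Xs.
- apply: free; apply: coboundary_ext (coboundary_pull uk Bc); first exact: ltr01.
  move=> s [Ys _] _ /=; rewrite !fct_sumE; apply: eq_bigr => i _.
  rewrite !fctE /=; congr (_ *: e _ _).
  rewrite -map_comp -[RHS]map_id; by apply/eq_in_map => x xs /=; exact/hk/Ys.
Qed.

End AlexanderSpanier.

(** * Mayer-Vietoris *)

Section MayerVietoris.
Variables (R : realType) (F : fieldType) (U : pseudoMetricType R).
Implicit Types (X Y : set U) (f g : seq U -> F^o) (p q : bool).

(** A metric substitute for open covers, satisfied by the closed pieces met below: two hemispheres,
    two subcomplexes. *)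
Definition excisive (A B : set U) := forall eta : R, 0 < eta ->
  exists2 dlt : R, 0 < dlt & forall x y, A x -> B y -> ball x dlt y ->
    exists z, [/\ A z, B z & ball x eta z].

Variables (A B : set U).
Hypothesis exAB : excisive A B.
Let C : set U := (A `&` B)%classic.
Let X : set U := (A `|` B)%classic.

Let inC x : A x -> B x -> C x. Proof. by split. Qed.
Let CA x : C x -> A x. Proof. by case. Qed.
Let CB x : C x -> B x. Proof. by case. Qed.
Let AX x : A x -> X x. Proof. by left. Qed.
Let BX x : B x -> X x. Proof. by right. Qed.

(* Moving the points near [A `&` B] into it, discontinuously, makes every small
   list lie in [A] or in [B]. *)
Lemma excisive_retract (eps : R) : 0 < eps -> exists (rho : U -> U) (dlt : R),
  [/\ 0 < dlt, forall x, A x -> A (rho x), forall x, B x -> B (rho x),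
      forall Y s, small Y dlt s ->
         {in s ++ map rho s &, forall x y, ball x eps y}
    & forall s, small X dlt s ->
         {in s, forall x, A (rho x)} \/ {in s, forall x, B (rho x)}].
Proof.
(* Each point of [s ++ map rho s] is [eta]-close to a point of [s], and points of [s] are
   [eta]-close to each other: three moves in all. *)
move=> e0; pose eta := eps / 3; have eta0 : 0 < eta by rewrite divr_gt0.
have [d0 d00 Hd] := exAB (divr_gt0 eta0 (ltr0n _ 2)).
pose dlt := Num.min d0 (eta / 2).
have dlt0 : 0 < dlt by rewrite lt_min d00 divr_gt0.
have dlt_eta : dlt <= eta / 2 by rewrite ge_min lexx orbT.
have /choice[rho rhoP] x : exists y, [/\ ball x eta y, A x -> A y, B x -> B y
    & (exists z, [/\ A z, B z & ball x eta z]) -> A y /\ B y].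
  have [[z [Az Bz xz]]|nz] := pselect (exists z, [/\ A z, B z & ball x eta z]).
    by exists z; split.
  by exists x; split=> //; apply: ballxx.
exists rho, dlt; split => [//|x|x|Y s [_ sm]|s [sX sm]]; try by case: (rhoP x).
  have near z : z \in s ++ map rho s -> exists2 x, x \in s & ball x eta z.
    rewrite mem_cat => /orP[zs|/mapP[x xs ->]].
      by exists z => //; apply: ballxx.
    by exists x => //; case: (rhoP x).
  move=> z1 z2 /near[x1 x1s b1] /near[x2 x2s b2].
  have -> : eps = eta + (eta + eta) by rewrite /eta; field.
  apply: ball_triangle (ball_sym b1) _; apply: ball_triangle b2.
  apply: le_ball (sm _ _ x1s x2s); lra.
have [allA|/existsNP[u /not_implyP[us nAu]]] := pselect (forall x, x \in s -> A x).
  by left=> x /allA; case: (rhoP x).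
have [allB|/existsNP[v /not_implyP[vs nBv]]] := pselect (forall x, x \in s -> B x).
  by right=> x /allB; case: (rhoP x).
have Bu : B u by case: (sX _ us).
have Av : A v by case: (sX _ vs).
have [|z [Az Bz vz]] := Hd _ _ Av Bu.
  by apply: le_ball (sm _ _ vs us); rewrite ge_min lexx.
(* Here [s] leaves both [A] and [B], so all its points are [eta]-close to the single point [z] of
   the intersection, and [rho] moves them into it; [A] is an arbitrary choice of side. *)
left=> x xs; case: (rhoP x) => _ _ _ []// .
exists z; split=> //; rewrite (splitr eta); apply: ball_triangle vz.
exact: le_ball (sm _ _ xs vs).
Qed.

Let allA (s : seq U) : bool := `[< {in s, forall x, A x} >].

(** The prism between the identity and [rho] bounds the difference: [rho] may be discontinuous, as
    it keeps small lists small. *)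
Lemma pull_retract Y p f (eps dlt : R) (rho : U -> U) : 0 < dlt ->
  (forall x, Y x -> Y (rho x)) ->
  (forall s, small Y dlt s -> {in s ++ map rho s &, forall x y, ball x eps y}) ->
  (forall s, small Y eps s -> odd (size s) = ~~ p -> cobd s f = 0) ->
  exists h, forall s, small Y dlt s -> odd (size s) = p ->
    f (map rho s) - f s = cobd s h.
Proof.
move=> d0 Yrho rho_near fE; exists (fun t => prism id rho t f) => s sm os.
rewrite -{2}[s]map_id; apply: (close_pull (X := Y) d0 fE) => // t tm.
rewrite map_id; split; last exact: rho_near.
move=> x; rewrite mem_cat => /orP[|/mapP[y ys ->]]; first exact: tm.1.
exact/Yrho/tm.1.
Qed.

Lemma odd_sub p (s t : seq U) : size s = (size t).+1 -> odd (size s) = ~~ p ->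
  odd (size t) = p.
Proof. by move=> st os; apply: negb_inj; rewrite -os st. Qed.

(** Exactness of Mayer-Vietoris at [A] and [B]: correcting [fA] by [cobd g] makes the cochains agree
    on the intersection, and composing with [rho] puts every small list in one piece. *)
Lemma glue_cocycles p fA fB :
  cocycle A p fA -> cocycle B p fB -> coboundary C p (fA - fB) ->
  exists f, [/\ cocycle X p f, coboundary A p (f - fA) & coboundary B p (f - fB)].
Proof.
move=> [eA eA0 fAE] [eB eB0 fBE] [g [eC eC0 gE]].
pose eps := Num.min eA (Num.min eB eC).
have e0 : 0 < eps by rewrite !lt_min eA0 eB0.
have leA : eps <= eA by rewrite ge_min lexx.
have leB : eps <= eB by rewrite !ge_min lexx orbT.
have leC : eps <= eC by rewrite !ge_min lexx !orbT.
pose f s : F^o := if allA s then fA s - cobd s g else fB s.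
have fA' s : {in s, forall x, A x} -> f s = fA s - cobd s g.
  by move=> sA; rewrite /f ifT //; apply/asboolP.
have fB' s : small B eps s -> odd (size s) = p -> f s = fB s.
  move=> sm os; rewrite /f; case: ifPn => // /asboolP sA.
  apply/eqP; rewrite subr_eq addrC -subr_eq; apply/eqP.
  apply: gE os; apply: small_le leC _.
  by split; [move=> x xs; apply: inC; [exact: sA|exact: sm.1]|exact: sm.2].
have cA s : small A eps s -> odd (size s) = ~~ p -> cobd s f = 0.
  move=> sm os; rewrite -[RHS](fAE s) //; last exact: small_le leA sm.
  rewrite -[RHS]subr0 -[X in _ - X](cobdK s g) -linearB /=.
  by apply: eq_cobd => t ts st; apply: fA' => x /ts; apply: sm.1.
have cB s : small B eps s -> odd (size s) = ~~ p -> cobd s f = 0.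
  move=> sm os; rewrite -[RHS](fBE s) //; last exact: small_le leB sm.
  apply: eq_cobd => t ts st; apply: fB'; first exact: small_sub sm.
  exact: odd_sub st os.
have [rho [dlt [d0 rA rB rnear rX]]] := excisive_retract e0.
exists (f \o map rho); split.
- exists dlt => // s sm os; rewrite -cobd_map.
  have near := rnear _ _ sm.
  have sm2 : {in map rho s &, forall x y, ball x eps y}.
    by move=> x y xs ys; apply: near; rewrite mem_cat (xs, ys) orbT.
  have [sA|sB] := rX _ sm.
    apply: cA; rewrite ?size_map //; split=> // _ /mapP[x xs ->]; exact: sA.
  apply: cB; rewrite ?size_map //; split=> // _ /mapP[x xs ->]; exact: sB.
- have [h hE] := pull_retract d0 rA (rnear A) cA.
  exists (h - g), dlt => // s sm os; rewrite linearB /= -hE // -addrA -opprD.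
  by rewrite (fA' s) ?subrK //; apply: sm.1.
- have [h hE] := pull_retract d0 rB (rnear B) cB.
  exists h, (Num.min dlt eps); first by rewrite lt_min d0.
  move=> s sm os; rewrite -hE //; last by apply: small_le sm; rewrite ge_min lexx.
  by rewrite (fB' s) //; apply: small_le sm; rewrite ge_min lexx orbT.
Qed.

(** Exactness at the union: the same gluing, applied to primitives. *)
Lemma coboundary_union p f a b :
  cocycle X p f -> primitive A p f a -> primitive B p f b ->
  coboundary C (~~ p) (a - b) -> coboundary X p f.
Proof.
move=> [eX eX0 fXE] [eA eA0 fAE] [eB eB0 fBE] [g [eC eC0 gE]].
pose eps := Num.min eX (Num.min eA (Num.min eB eC)).
have e0 : 0 < eps by rewrite !lt_min eX0 eA0 eB0.
have leX : eps <= eX by rewrite ge_min lexx.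
have leA : eps <= eA by rewrite !ge_min lexx ?orbT.
have leB : eps <= eB by rewrite !ge_min lexx ?orbT.
have leC : eps <= eC by rewrite !ge_min lexx ?orbT.
pose h s : F^o := if allA s then a s - cobd s g else b s.
have cA s : small A eps s -> odd (size s) = p -> f s = cobd s h.
  move=> sm os; rewrite fAE //; last exact: small_le leA sm.
  rewrite -[LHS]subr0 -[X in _ - X](cobdK s g) -linearB /=.
  apply: eq_cobd => t ts st; rewrite /h ifT //; apply/asboolP => x /ts.
  exact: sm.1.
have cB s : small B eps s -> odd (size s) = p -> f s = cobd s h.
  move=> sm os; rewrite fBE //; last exact: small_le leB sm.
  apply: eq_cobd => t ts st; rewrite /h; case: ifPn => // /asboolP tA.
  apply/esym/eqP; rewrite subr_eq addrC -subr_eq; apply/eqP.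
  apply: gE.
    have tsm := small_sub ts sm; apply: small_le leC _.
    by split; [move=> x xs; apply: inC; [exact: tA|exact: tsm.1]|exact: tsm.2].
  by apply: odd_sub st _; rewrite os negbK.
have [rho [dlt [d0 rA rB rnear rX]]] := excisive_retract e0.
have rXX x : X x -> X (rho x) by case=> [/rA/AX|/rB/BX].
have fX' s : small X eps s -> odd (size s) = ~~ p -> cobd s f = 0.
  by move=> sm; apply: fXE; apply: small_le leX sm.
have [k kE] := pull_retract d0 rXX (rnear X) fX'.
exists (h \o map rho - k), dlt => // s sm os.
rewrite linearB /= -kE // -cobd_map opprB.
suff <- : f (map rho s) = cobd (map rho s) h by rewrite addrC subrK.
have near := rnear _ _ sm.
have sm2 : {in map rho s &, forall x y, ball x eps y}.
  by move=> x y xs ys; apply: near; rewrite mem_cat (xs, ys) orbT.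
have [sA|sB] := rX _ sm.
  apply: cA; rewrite ?size_map //; split=> // _ /mapP[x xs ->]; exact: sA.
apply: cB; rewrite ?size_map //; split=> // _ /mapP[x xs ->]; exact: sB.
Qed.

(** The connecting map: extend [cobd w] by 0 to lists not in [A], and compose with [rho]; on [A] a
    primitive is [w \o map rho], on [B] it is 0. *)
Lemma connecting_cocycle q w : cocycle C q w ->
  exists f a b, [/\ cocycle X (~~ q) f, primitive A (~~ q) f a,
    primitive B (~~ q) f b & coboundary C q (a - b - w)].
Proof.
move=> [eps e0 wE].
pose f s : F^o := if allA s then cobd s w else 0.
have cA s : {in s, forall x, A x} -> f s = cobd s w.
  by move=> sA; rewrite /f ifT //; apply/asboolP.
have cB s : small B eps s -> odd (size s) = ~~ q -> f s = 0.
  move=> sm os; rewrite /f; case: ifPn => // /asboolP sA; apply: wE => //.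
  by split; [move=> x xs; apply: inC; [exact: sA|exact: sm.1]|exact: sm.2].
have [rho [dlt [d0 rA rB rnear rX]]] := excisive_retract e0.
have rC x : C x -> C (rho x) by case=> /rA ? /rB ?; split.
have smr s Y : small Y dlt s -> {in map rho s &, forall x y, ball x eps y}.
  by move=> sm x y xs ys; apply: (rnear _ _ sm); rewrite mem_cat (xs, ys) orbT.
exists (f \o map rho), (w \o map rho), 0; split.
- exists dlt => // s sm; rewrite negbK -cobd_map => os.
  have [sA|sB] := rX _ sm.
    rewrite -(cobdK (map rho s) w); apply: eq_cobd => t ts st.
    by apply: cA => x /ts /mapP[y ys ->]; apply: sA.
  rewrite -[RHS](linear0 (cobd (map rho s))); apply: eq_cobd => t ts st.
  apply: cB; last by apply: odd_sub st _; rewrite size_map negbK.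
  apply: small_sub ts _; split; last exact: smr sm.
  by move=> _ /mapP[x xs ->]; apply: sB.
- exists dlt => // s sm os /=; rewrite cA ?cobd_map //.
  by move=> _ /mapP[x xs ->]; apply/rA/sm.1.
- exists dlt => // s sm os /=; rewrite linear0 cB ?size_map //.
  by split; [move=> _ /mapP[x xs ->]; apply/rB/sm.1|exact: smr sm].
- rewrite subr0.
  have [h hE] := pull_retract d0 rC (rnear C) wE.
  by exists h, dlt.
Qed.

End MayerVietoris.

(** * Attaching an acyclic piece along a sphere *)

Section Attaching.
Variables (R : realType) (F : fieldType) (U : pseudoMetricType R).
Implicit Types (f g : seq U -> F^o) (p q : bool).

(* The sign is that of minus the reduced Euler characteristic, because a list of
   length n has dimension n - 1. *)
Definition has_euler (X : set U) (e : int) := exists2 x : bool -> nat,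
  forall p, coh_dim F X p (x p) & e = (x false)%:Z - (x true)%:Z.

Lemma has_euler_inj X e e' : has_euler X e -> has_euler X e' -> e = e'.
Proof.
move=> [x dx ->] [y dy ->].
by rewrite (coh_dim_inj (dx false) (dy false)) (coh_dim_inj (dx true) (dy true)).
Qed.

(** One reduced class in all, in length parity [q]; the sphere of dimension [n - 1] has
    [q = odd n]. *)
Definition sphere_like (X : set U) q := coh_dim F X q 1 /\ coh_dim F X (~~ q) 0.

Lemma sphere_like_euler X q : sphere_like X q -> has_euler X ((-1) ^+ q).
Proof.
case=> X1 X0; exists (fun p => (p == q)%N : nat); last by case: q {X1 X0}.
by move=> p; case: eqVneq => [->//|]; case: p q X1 X0 => -[].
Qed.

Lemma primitiveL (X : set U) p a f g h k : primitive X p f h -> primitive X p g k ->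
  primitive X p (a *: f + g) (a *: h + k).
Proof.
move=> [e1 e10 f1] [e2 e20 g2]; exists (Num.min e1 e2).
  by rewrite lt_min e10.
move=> s sm os; rewrite linearP /= -f1 -?g2 //.
  by apply: small_le sm; rewrite ge_min lexx orbT.
by apply: small_le sm; rewrite ge_min lexx.
Qed.

Lemma primitive0 (X : set U) p f : cocycle X (~~ p) f -> primitive X p 0 f.
Proof. by case=> e e0 fE; exists e => // s sm os; rewrite fE ?negbK. Qed.

Lemma cocycle_primitive0 (X : set U) p f : primitive X p 0 f -> cocycle X (~~ p) f.
Proof. by case=> e e0 fE; exists e => // s sm; rewrite negbK => /(fE _ sm). Qed.

Lemma primitive_subset (X Y : set U) p f h : (forall x, X x -> Y x) ->
  primitive Y p f h -> primitive X p f h.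
Proof. by move=> XY [e e0 fE]; exists e => // s /(small_subset XY); apply: fE. Qed.

Variables (A B : set U).
Hypotheses (exAB : excisive A B) (acB : acyclic F B).
Let C : set U := (A `&` B)%classic.
Let X : set U := (A `|` B)%classic.

Let CA x : C x -> A x. Proof. by case. Qed.
Let CB x : C x -> B x. Proof. by case. Qed.
Let AX x : A x -> X x. Proof. by left. Qed.
Let BX x : B x -> X x. Proof. by right. Qed.

(** Up to coboundaries, the cocycles of [A] that extend to the union: as [B] is acyclic, triviality
    on [C] is the condition. *)
Let K p f := cocycle A p f /\ coboundary C p f.

Let liftK p fA : K p fA -> exists2 f, cocycle X p f & coboundary A p (f - fA).
Proof.
case=> cA cC; have [||f [cX bA _]] := glue_cocycles exAB cA (fB := 0).
- exact: (cocycle_subspace F B p).1.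
- by rewrite subr0.
by exists f.
Qed.

Let primB p f : cocycle X p f -> exists b, primitive B p f b.
Proof. by move=> /(cocycle_subset BX)/acB. Qed.

Let restrK p f : cocycle X p f -> K p f.
Proof.
move=> cX; split; first exact: cocycle_subset cX.
by have [b /(primitive_subset CB)] := primB cX; exists b.
Qed.

Let diffC p f a b : primitive A p f a -> primitive B p f b -> cocycle C (~~ p) (a - b).
Proof.
move=> /(primitive_subset CA) Aa /(primitive_subset CB) Bb.
apply: cocycle_primitive0.
have := primitiveL (-1) Bb Aa.
by rewrite !scaleN1r addNr addrC.
Qed.

(** When the connecting map into parity [p] vanishes, restriction to [A] is injective on the
    cohomology of the union, with image that of [K]. *)
Let coh_dim_unobstructed p n : quot_dim (K p) (coboundary A p) n ->
  (forall f, cocycle C (~~ p) f ->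
     exists2 fA, cocycle A (~~ p) fA & coboundary C (~~ p) (f - fA)) ->
  coh_dim F X p n.
Proof.
move=> [e [Ke span free]] unobs.
have /choice[E EP] i : exists f, cocycle X p f /\ coboundary A p (f - e i).
  by have [f] := liftK (Ke i); exists f.
have sA := coboundary_subspace F A p.
have EA c : coboundary A p (\sum_i c i *: E i - \sum_i c i *: e i).
  rewrite -sumrB; under eq_bigr do rewrite -scalerBr.
  by apply: subspace_sum => // i _; case: (EP i).
exists E; split => [i|v Zv|c Bc].
- by case: (EP i).
- have [c Bc] := span _ (restrK Zv); exists c.
  set w := v - _.
  have Xw : cocycle X p w.
    apply: subspaceB => //; first exact: cocycle_subspace.
    apply: subspace_sum => [|i _]; first exact: cocycle_subspace.
    by case: (EP i).
  have [a wa] : coboundary A p w.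
    have -> : w = (v - \sum_i c i *: e i) - (\sum_i c i *: E i - \sum_i c i *: e i).
      by rewrite opprB addrA subrK.
    exact: subspaceB.
  have [b wb] := primB Xw.
  have [fA cfA Cab] := unobs _ (diffC wa wb).
  apply: (coboundary_union exAB (a := a - fA) Xw _ wb).
    have := primitiveL (-1) (primitive0 cfA) wa.
    by rewrite scaler0 add0r scaleN1r addrC.
  by rewrite addrAC.
- apply: free.
  rewrite -[X in coboundary _ _ X](subKr (\sum_i c i *: E i)).
  apply: subspaceB => //; exact: coboundary_subset Bc.
Qed.

Variable q : bool.
Hypothesis C_sphere : sphere_like C q.

Let acC f : cocycle C (~~ q) f -> coboundary C (~~ q) f.
Proof. by move=> cC; apply: quot_dim0P C_sphere.2 cC. Qed.

Let K_all p n : (forall f, cocycle A p f -> coboundary C p f) ->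
  coh_dim F A p n -> quot_dim (K p) (coboundary A p) n.
Proof.
move=> AC [e [Ze span free]]; exists e; split=> //.
  by move=> i; split=> //; apply: AC.
by move=> v [/span].
Qed.

Let unobs_q f : cocycle C (~~ q) f ->
  exists2 fA, cocycle A (~~ q) fA & coboundary C (~~ q) (f - fA).
Proof.
move=> /acC bC; exists 0; first exact: (cocycle_subspace F A (~~ q)).1.
by rewrite subr0.
Qed.

Let AC_nq f : cocycle A (~~ q) f -> coboundary C (~~ q) f.
Proof. by move=> /(cocycle_subset CA)/acC. Qed.

(** Restriction to the one-dimensional cohomology of [C] is onto, so its kernel [K] is a hyperplane
    and parity [q] loses one class. *)
Let coh_dim_surj n f0 : cocycle A q f0 -> ~ coboundary C q f0 ->
  coh_dim F A q n -> exists2 m, n = m.+1 & coh_dim F X q m.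
Proof.
move=> cf0 nf0 dA; have [e [Ze span free]] := C_sphere.1.
have sC := coboundary_subspace F C q.
have [c0 Bc0] := span _ (cocycle_subset CA cf0).
rewrite big_ord1 in Bc0.
have c00 : c0 ord0 != 0.
  by apply: contra_notN nf0 => /eqP c00; move: Bc0; rewrite c00 scale0r subr0.
have [] := @quot_dim_hyperplane F _ (cocycle A q) (coboundary A q) (K q) n f0.
- exact: coboundary_subspace.
- split; first by split; [apply: (cocycle_subspace F A q).1|apply: sC.1].
  move=> a u v [Zu Cu] [Zv Cv]; split; last exact: sC.2.
  exact: (cocycle_subspace F A q).2.
- move=> v bA; split; first exact: coboundary_cocycle.
  exact: coboundary_subset bA.
- by move=> v [].
- exact: cocycle_subspace.
- exact: cf0.
- by case.
- move=> v Zv; have [c Bc] := span _ (cocycle_subset CA Zv).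
  rewrite big_ord1 in Bc; exists (c ord0 / c0 ord0); split.
    apply: subspaceB => //; first exact: cocycle_subspace.
    by apply: subspaceZ => //; exact: cocycle_subspace.
  have -> : v - (c ord0 / c0 ord0) *: f0 = (v - c ord0 *: e ord0)
      - (c ord0 / c0 ord0) *: (f0 - c0 ord0 *: e ord0).
    by rewrite scalerBr scalerA divfK // opprB addrA subrK.
  by apply: subspaceB => //; apply: subspaceZ.
- exact: dA.
move=> m -> dK; exists m => //; exact: coh_dim_unobstructed dK unobs_q.
Qed.

(** The class of [C] comes from [A], so the connecting map kills it and the opposite parity is
    unchanged. *)
Let coh_dim_surj' n f0 : cocycle A q f0 -> ~ coboundary C q f0 ->
  coh_dim F A (~~ q) n -> coh_dim F X (~~ q) n.
Proof.
move=> cf0 nf0 dA; have [e [Ze span free]] := C_sphere.1.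
have sC := coboundary_subspace F C q.
have [c0 Bc0] := span _ (cocycle_subset CA cf0).
rewrite big_ord1 in Bc0.
have c00 : c0 ord0 != 0.
  by apply: contra_notN nf0 => /eqP c00; move: Bc0; rewrite c00 scale0r subr0.
apply: coh_dim_unobstructed (K_all AC_nq dA) _ => v; rewrite negbK => Zv.
have [c Bc] := span _ Zv; rewrite big_ord1 in Bc.
exists ((c ord0 / c0 ord0) *: f0).
  by apply: subspaceZ => //; exact: cocycle_subspace.
have -> : v - (c ord0 / c0 ord0) *: f0 = (v - c ord0 *: e ord0)
    - (c ord0 / c0 ord0) *: (f0 - c0 ord0 *: e ord0).
  by rewrite scalerBr scalerA divfK // opprB addrA subrK.
by apply: subspaceB => //; apply: subspaceZ.
Qed.

(** No class of [A] reaches that of [C], so the connecting map turns the generator [w] of [C] into a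
    new class [D]. *)
Let coh_dim_zero n : (forall f, cocycle A q f -> coboundary C q f) ->
  coh_dim F A (~~ q) n -> coh_dim F X (~~ q) n.+1.
Proof.
move=> AC dA; have [w [Zw span_w free_w]] := C_sphere.1.
have [e [Ze span free]] := dA.
have sA := coboundary_subspace F A (~~ q).
have sC := coboundary_subspace F C q.
have sX := cocycle_subspace F X (~~ q).
have /choice[E EP] i : exists f, cocycle X (~~ q) f /\ coboundary A (~~ q) (f - e i).
  by have [f] := liftK (conj (Ze i) (AC_nq (Ze i))); exists f.
have EA c : coboundary A (~~ q) (\sum_i c i *: E i - \sum_i c i *: e i).
  rewrite -sumrB; under eq_bigr do rewrite -scalerBr.
  by apply: subspace_sum => // i _; case: (EP i).
have [D [aD [bD [XD Da Db Dw]]]] := connecting_cocycle exAB (Zw ord0).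
pose G (i : 'I_n.+1) := if unlift ord0 i is Some j then E j else D.
have GE c : \sum_i c i *: G i = c ord0 *: D + \sum_j c (lift ord0 j) *: E j.
  rewrite big_ord_recl /G unlift_none; congr (_ + _).
  by apply: eq_bigr => j _; rewrite fintype.liftK.
exists G; split => [i|v Zv|c Bc].
- by rewrite /G; case: unliftP => [j|] _ //; case: (EP j).
- have [c Bc] := span _ (cocycle_subset AX Zv).
  set u := v - \sum_i c i *: E i.
  have Xu : cocycle X (~~ q) u.
    apply: subspaceB => //; apply: subspace_sum => // i _.
    by case: (EP i).
  have [a ua] : coboundary A (~~ q) u.
    have -> : u = (v - \sum_i c i *: e i) - (\sum_i c i *: E i - \sum_i c i *: e i).
      by rewrite opprB addrA subrK.
    exact: subspaceB.
  have [b ub] := primB Xu.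
  have := diffC ua ub; rewrite negbK => /span_w[t]; rewrite big_ord1 => Bt.
  (* On [C] the primitives [a] and [b] of the remainder [u] differ by [t ord0] times [w], up to a
     coboundary; this multiple of [D] absorbs it. *)
  exists (fun i => if unlift ord0 i is Some j then c j else t ord0).
  rewrite GE unlift_none; under eq_bigr do rewrite fintype.liftK.
  have -> : v - (t ord0 *: D + \sum_i c i *: E i) = - t ord0 *: D + u.
    by rewrite opprD addrCA scaleNr.
  apply: (coboundary_union exAB _ (primitiveL _ Da ua) (primitiveL _ Db ub)).
    by apply: subspaceD => //; apply: subspaceZ.
  have -> : - t ord0 *: aD + a - (- t ord0 *: bD + b) =
      (a - b - t ord0 *: w ord0) - t ord0 *: (aD - bD - w ord0).
    rewrite !scalerBr !scaleNr (opprB _ (_ *: w _)) [RHS]addrA subrK opprB.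
    by rewrite opprD opprK addrACA addrC [- _ + _]addrC.
  by rewrite negbK; apply: subspaceB => //; apply: subspaceZ.
have c_lift j : c (lift ord0 j) = 0.
  apply: (free (fun j => c (lift ord0 j))).
  rewrite -[X in coboundary _ _ X](subKr (\sum_j c (lift ord0 j) *: E j)).
  apply: subspaceB => //.
  rewrite -[X in coboundary _ _ X](addKr (c ord0 *: D)) -GE.
  apply: subspaceD => //; last exact: coboundary_subset Bc.
  by apply: subspaceN => //; apply: subspaceZ => //; exists aD.
(* A primitive [h] of [c ord0 *: D] makes [c ord0 *: w], up to a coboundary, a difference of
   cocycles of [A] and [B], both trivial on [C]; freeness of [w] concludes. *)
suff c00 : c ord0 = 0.
  by move=> i; case: (unliftP ord0 i) => [j|] ->; [apply: c_lift|apply: c00].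
move: Bc; rewrite GE big1 ?addr0 => [[h hE]|j _]; last by rewrite c_lift scale0r.
have prim0 Y k : primitive Y (~~ q) D k -> (forall x, Y x -> X x) ->
    cocycle Y q (c ord0 *: k - h).
  move=> Dk YX; rewrite -[q]negbK; apply: cocycle_primitive0.
  have := primitiveL (-1) (primitive_subset YX hE)
    (primitiveL (c ord0) Dk (primitive0 ((cocycle_subspace F Y _).1))).
  by rewrite !addr0 !scaleN1r addNr addrC.
have bA := AC _ (prim0 _ _ Da AX).
have bB := coboundary_subset CB (acB (prim0 _ _ Db BX)).
apply: (free_w (fun=> c ord0) _ ord0); rewrite big_ord1.
have -> : c ord0 *: w ord0 = ((c ord0 *: aD - h) - (c ord0 *: bD - h))
   - c ord0 *: (aD - bD - w ord0).
  by rewrite !scalerBr (opprB _ h) addrA subrK subKr.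
by apply: subspaceB; [|exact: subspaceB|exact: subspaceZ].
Qed.

(** Losing a class of parity [q] and gaining one of parity [~~ q] change the alternating sum
    equally. *)
Lemma has_euler_attach e : has_euler A e -> has_euler X (e - (-1) ^+ q).
Proof.
case=> a dA ->.
have [[f0 [cf0 nf0]]|none] :=
    pselect (exists f0, cocycle A q f0 /\ ~ coboundary C q f0).
  have [m am dq] := coh_dim_surj cf0 nf0 (dA q).
  have dnq := coh_dim_surj' cf0 nf0 (dA (~~ q)).
  exists (fun p => if p == q then m else a p).
    by move=> p; case: eqVneq => [->//|]; case: p q dnq => -[].
  by case: q am => /= -> ; rewrite ?expr0 ?expr1 intS; ring.
have AC f : cocycle A q f -> coboundary C q f.
  by move=> cA; apply: contrapT => nC; apply: none; exists f.
have dq := coh_dim_unobstructed (K_all AC (dA q)) unobs_q.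
have dnq := coh_dim_zero AC (dA (~~ q)).
exists (fun p => if p == q then a q else (a (~~ q)).+1).
  by move=> p; case: eqVneq => [->//|]; case: p q dnq => -[].
by case: q => /=; rewrite ?expr0 ?expr1 intS; ring.
Qed.

Lemma sphere_like_suspension : acyclic F A -> sphere_like X (~~ q).
Proof.
move=> acA; have AC f : cocycle A q f -> coboundary C q f.
  by move=> /acA /(coboundary_subset CA).
split; first exact: coh_dim_zero AC (acyclic_dim _ acA).
by rewrite negbK; apply: coh_dim_unobstructed (K_all AC (acyclic_dim _ acA)) unobs_q.
Qed.

End Attaching.

(** * Contractible spaces and spheres *)

Section Spheres.
Variables (R : realType) (F : fieldType).

(** The only list is the empty one; it has even length and no faces, so its value is a nontrivial
    class of parity [false]. *)
Lemma sphere_like_set0 (U : pseudoMetricType R) :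
  sphere_like F (set0 : set U) false.
Proof.
have nil_small e s : small (set0 : set U) e s -> s = [::].
  by case: s => // x s [/(_ x)] /(_ (mem_head _ _)).
split; last first.
  by apply: quot_dim0 => f _; exists 0, 1 => // s /nil_small->.
exists (fun=> fun=> 1); split => [_|v _|c [g [e e0 E]] i].
- by exists 1 => // s /nil_small->.
- exists (fun=> v [::]); exists 0, 1 => // s /nil_small-> _.
  by rewrite big_ord1 !fctE /= -[_ *: _]/(v [::] * 1) mulr1 subrr.
have /(E [::]) : small (set0 : set U) e [::] by [].
by move=> /(_ erefl); rewrite big_ord1 (ord1 i) => /= <-; rewrite fctE -[RHS]/(_ * 1) mulr1.
Qed.

(** Finitely many short non-expanding steps, their number depending on [eps], replace a continuous
    homotopy: the prisms of the steps add up, and a cone over [c] handles the constant end. *)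
Lemma acyclic_contraction (U : pseudoMetricType R) (X : set U) (c : U) : X c ->
  (forall eps : R, 0 < eps -> exists (m : nat) (h : nat -> U -> U),
    [/\ forall j x, X x -> X (h j x),
        forall j x y dlt, X x -> X y -> ball x dlt y -> ball (h j x) dlt (h j y),
        forall j x, X x -> ball (h j x) eps (h j.+1 x),
        forall x, h 0%N x = c & forall x, X x -> h m x = x]) ->
  acyclic F X.
Proof.
move=> Xc contr p f [eps e0 fE].
pose dlt := eps / 2; have d0 : 0 < dlt by rewrite divr_gt0.
have [m [h [hX hn hs h0 hm]]] := contr _ d0.
have close j s : small X dlt s -> small X eps (map (h j) s ++ map (h j.+1) s).
  move=> [sX sb]; split.
    by move=> x; rewrite mem_cat => /orP[] /mapP[y ys ->]; apply/hX/sX.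
  have hb i x y : x \in s -> y \in s -> ball (h i x) dlt (h i y).
    by move=> xs ys; apply: hn (sX _ xs) (sX _ ys) (sb _ _ xs ys).
  have le_d : dlt <= eps by rewrite /dlt; lra.
  have cross x y : x \in s -> y \in s -> ball (h j x) eps (h j.+1 y).
    move=> xs ys; rewrite (splitr eps).
    exact: ball_triangle (hb j _ _ xs ys) (hs _ _ (sX _ ys)).
  move=> u v; rewrite !mem_cat => /orP[] /mapP[x xs ->] /orP[] /mapP[y ys ->].
  - exact: le_ball (hb _ _ _ xs ys).
  - exact: cross.
  - by apply: ball_sym; apply: cross.
  - exact: le_ball (hb _ _ _ xs ys).
have step j : exists g, forall s, small X dlt s -> odd (size s) = p ->
    f (map (h j) s) - f (map (h 0%N) s) = cobd s g.
  elim: j => [|j [g gE]]; first by exists 0 => s _ _; rewrite linear0 subrr.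
  exists (g + (fun t => prism (h j) (h j.+1) t f)) => s sm os.
  rewrite linearD /= -gE // -(close_pull d0 fE (close j)) //.
  by rewrite [RHS]addrC [RHS]addrA subrK.
have [g gE] := step m.
(* The list [c :: map (h 0%N) s] is constant, hence small; the cocycle condition on it gives a
   primitive at the end [h 0%N]. *)
exists (g + ((fun t => f (c :: t)) \o map (h 0%N))), dlt => // s sm os.
rewrite (linearD (cobd s)) /= -gE //.
have -> : map (h m) s = s.
  by rewrite -[RHS]map_id; apply/eq_in_map => x /sm.1/hm.
have : cobd (c :: map (h 0%N) s) f = 0.
  apply: fE; last by rewrite /= size_map os.
  split=> [x|x y]; rewrite inE.
    by case/predU1P => [->//|/mapP[y _ ->]]; rewrite h0.
  have cc z : (z == c) || (z \in map (h 0%N) s) -> z = c.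
    by case/predU1P => [->//|/mapP[? _ ->]]; rewrite h0.
  by move=> /cc-> ; rewrite inE => /cc->; apply: ballxx.
by move=> /= /eqP; rewrite subr_eq0 cobd_map => /eqP <-; rewrite subrK.
Qed.

(** Balls of row vectors are those of the sup norm, so all estimates below are made coordinate by
    coordinate. *)
Lemma ball_rV n (x y : 'rV[R]_n) (e : R) :
  ball x e y <-> 0 < e /\ forall i, `|x ord0 i - y ord0 i| < e.
Proof.
split=> -[e0 H]; split=> //.
  by move=> i; apply: H.
by move=> i j; rewrite (ord1 i); apply: H.
Qed.

Lemma acyclic_star n (X : set 'rV[R]_n) (c : 'rV[R]_n) (M : R) : X c ->
  (forall x i, X x -> `|x ord0 i - c ord0 i| <= M) ->
  (forall x t, X x -> 0 <= t <= 1 -> X (c + t *: (x - c))) ->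
  acyclic F X.
Proof.
move=> Xc XM Xstar; apply: (acyclic_contraction Xc) => eps e0.
(* Enough steps for [M / m%:R] to stay below [eps]; as [h] is indexed by all naturals, [minn] below
   freezes the time after [m]. *)
pose m := (Num.bound (`|M| / eps)).+1.
have m0 : 0 < m%:R :> R by rewrite ltr0n.
have Mm : M / m%:R < eps.
  rewrite ltr_pdivrMr // mulrC -ltr_pdivrMr //.
  apply: le_lt_trans (_ : `|M| / eps < _).
    by rewrite ler_pM2r ?invr_gt0 ?ler_norm.
  have b0 : 0 <= `|M| / eps by rewrite divr_ge0 // ltW.
  apply: lt_le_trans (archi_boundP b0) _.
  by rewrite ler_nat.
pose t j : R := (minn j m)%:R / m%:R.
have t01 j : 0 <= t j <= 1.
  by rewrite divr_ge0 ?ler0n //= ler_pdivrMr // mul1r ler_nat geq_minr.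
exists m, (fun j x => c + t j *: (x - c)); split.
- by move=> j x Xx; apply: Xstar.
- move=> j x y dlt Xx Xy /ball_rV[d0 H]; apply/ball_rV; split=> // i.
  have /andP[t0 t1] := t01 j; apply: le_lt_trans (H i).
  rewrite !mxE.
  have -> : c ord0 i + t j * (x ord0 i - c ord0 i) -
     (c ord0 i + t j * (y ord0 i - c ord0 i)) = t j * (x ord0 i - y ord0 i) by ring.
  by rewrite normrM (ger0_norm t0) ler_piMl.
- move=> j x Xx; apply/ball_rV; split=> // i; rewrite !mxE.
  have -> : c ord0 i + t j * (x ord0 i - c ord0 i) -
     (c ord0 i + t j.+1 * (x ord0 i - c ord0 i)) =
     - ((t j.+1 - t j) * (x ord0 i - c ord0 i)) by ring.
  rewrite normrN normrM; apply: le_lt_trans Mm; rewrite mulrC.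
  apply: ler_pM => //; first exact: XM.
  rewrite /t -mulrBl normrM [X in _ * X]ger0_norm ?invr_ge0 ?ler0n //.
  rewrite ler_piMl ?invr_ge0 ?ler0n // -natrB; last first.
    by rewrite leq_min !geq_min leqnSn ?leqnn ?orbT.
  rewrite normr_nat -[leRHS]/(1%:R) ler_nat; lia.
- by move=> x; rewrite /t min0n mul0r scale0r addr0.
- by move=> x _; rewrite /t minnn divff ?gt_eqF // scale1r addrC subrK.
Qed.

Lemma coh_dim_acyclic (U : pseudoMetricType R) (X : set U) :
  (forall p, coh_dim F X p 0) -> acyclic F X.
Proof. by move=> dX p f cf; apply: quot_dim0P (dX p) cf. Qed.

Lemma acyclic_homeo (U V : pseudoMetricType R) (X : set U) (Y : set V) h k :
  unif_map X Y h -> unif_map Y X k ->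
  (forall x, X x -> k (h x) = x) -> (forall y, Y y -> h (k y) = y) ->
  acyclic F Y -> acyclic F X.
Proof.
move=> uh uk kh hk aY; apply: coh_dim_acyclic => p.
exact: (coh_dim_homeo uh uk kh hk (acyclic_dim p aY)).
Qed.

Let drop n (x : 'rV[R]_n.+1) : 'rV[R]_n := \row_j x ord0 (lift ord0 j).
Let cons n (a : R) (y : 'rV[R]_n) : 'rV[R]_n.+1 :=
  \row_i if unlift ord0 i is Some j then y ord0 j else a.

Let cons0 n a (y : 'rV[R]_n) : cons a y ord0 ord0 = a.
Proof. by rewrite mxE unlift_none. Qed.
Let consS n a (y : 'rV[R]_n) j : cons a y ord0 (lift ord0 j) = y ord0 j.
Proof. by rewrite mxE liftK. Qed.
Let drop_cons n a (y : 'rV[R]_n) : drop (cons a y) = y.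
Proof. by apply/rowP => j; rewrite mxE consS. Qed.
Let cons_drop n (x : 'rV[R]_n.+1) : cons (x ord0 ord0) (drop x) = x.
Proof.
apply/rowP => i; case: (unliftP ord0 i) => [j|] ->; last by rewrite cons0.
by rewrite consS mxE.
Qed.

Let sumsq n (x : 'rV[R]_n) : R := \sum_i x ord0 i ^+ 2.

Let sumsq_cons n a (y : 'rV[R]_n) : sumsq (cons a y) = a ^+ 2 + sumsq y.
Proof.
by rewrite /sumsq big_ord_recl cons0; under eq_bigr do rewrite consS.
Qed.

Let sumsq_ge0 n (x : 'rV[R]_n) : 0 <= sumsq x.
Proof. by apply: sumr_ge0 => i _; apply: sqr_ge0. Qed.

Let sumsq_coord n (x : 'rV[R]_n) i : sumsq x <= 1 -> `|x ord0 i| <= 1.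
Proof.
move=> x1; rewrite -(@expr_le1 _ 2) // -normrX ger0_norm ?sqr_ge0 //.
apply: le_trans x1; rewrite /sumsq (bigD1 i) //= lerDl.
by apply: sumr_ge0 => j _; apply: sqr_ge0.
Qed.

Let disc n : set 'rV[R]_n := [set y | sumsq y <= 1]%classic.

Let acyclic_disc n : acyclic F (@disc n).
Proof.
apply: (@acyclic_star _ _ 0 1); rewrite /disc /= /sumsq.
- by rewrite big1 // => i _; rewrite mxE expr0n.
- by move=> x i /(@sumsq_coord _ x) H; rewrite mxE subr0.
- move=> x t x1 /andP[t0 t1]; apply: le_trans x1; apply: ler_sum => i _.
  rewrite !mxE oppr0 addr0 add0r exprMn ler_piMl ?sqr_ge0 //.
  by rewrite expr_le1.
Qed.

Let drop_unif n X Y : (forall x, X x -> Y (drop x)) ->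
  unif_map (X : set 'rV[R]_n.+1) (Y : set 'rV[R]_n) (@drop n).
Proof.
move=> XY; split=> // e e0; exists e => // x y _ _ /ball_rV[_ H].
by apply/ball_rV; split=> // i; rewrite !mxE.
Qed.

Let hemi n (sg : R) : set 'rV[R]_n.+1 :=
  [set x | unit_sphere R n.+1 x /\ 0 <= sg * x ord0 ord0]%classic.

(** For nonnegative [u] and [v], [|u - v| <= u + v], so the square of [|u - v|] is at most
    [|u^2 - v^2|]. *)
Let sqrt_near (a b e : R) : 0 < e -> 0 <= a -> 0 <= b -> `|a - b| < e ^+ 2 ->
  `|Num.sqrt a - Num.sqrt b| < e.
Proof.
move=> e0 a0 b0 abe; rewrite -(@ltr_pXn2r _ 2) ?nnegrE ?normr_ge0 ?ltW //.
apply: le_lt_trans abe.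
rewrite -{2}(sqr_sqrtr a0) -{2}(sqr_sqrtr b0) subr_sqr normrM expr2.
apply: ler_wpM2l => //; apply: le_trans (ler_normB _ _) _.
by rewrite !ger0_norm ?addr_ge0 ?sqrtr_ge0.
Qed.

(** Projection forgets the first coordinate and lands in the disc; the inverse restores it as a
    signed square root. *)
Let acyclic_hemi n sg : sg ^+ 2 = 1 -> acyclic F (@hemi n sg).
Proof.
move=> sg2; pose k y := cons (sg * Num.sqrt (1 - sumsq y)) (y : 'rV[R]_n).
apply: (acyclic_homeo (h := @drop n) (k := k) _ _ _ _ (@acyclic_disc n)).
- apply: drop_unif => x [x1 _]; rewrite /disc /=.
  rewrite -[x]cons_drop in x1; move: x1; rewrite /unit_sphere /= -/(sumsq _).
  by rewrite sumsq_cons => <-; rewrite lerDr sqr_ge0.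
- split=> [y y1|e e0].
    split; last by rewrite cons0 mulrA -expr2 sg2 mul1r sqrtr_ge0.
    rewrite /unit_sphere /= -/(sumsq _) sumsq_cons exprMn sg2 mul1r.
    by rewrite sqr_sqrtr ?subr_ge0 // subrK.
  (* Squared norms of [d]-close points of the disc differ by at most [2 * n%:R * d]; the [+ 1]
     covers [n = 0] and makes the bound strict. *)
  exists (Num.min e (e ^+ 2 / (2 * n%:R + 1))).
    by rewrite lt_min e0 divr_gt0 ?exprn_gt0 // ltr_wpDl // mulr_ge0.
  move=> x y x1 y1 /ball_rV[_ H]; apply/ball_rV; split=> // i.
  case: (unliftP ord0 i) => [j|] ->.
    by rewrite !consS; apply: lt_le_trans (H j) _; rewrite ge_min lexx.
  rewrite !cons0 -mulrBr normrM.
  have -> : `|sg| = 1.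
    by apply/eqP; rewrite -(@eqrXn2 _ 2) // -normrX sg2 normr1 expr1n.
  rewrite mul1r; apply: sqrt_near; rewrite ?subr_ge0 //.
  have -> : 1 - sumsq x - (1 - sumsq y) = sumsq y - sumsq x by ring.
  rewrite /sumsq -sumrB; apply: le_lt_trans (ler_norm_sum _ _ _) _.
  set d := e ^+ 2 / _ in H.
  apply: le_lt_trans (_ : \sum_(i < n) 2 * d < _).
    apply: ler_sum => j _; rewrite subr_sqr normrM mulrC.
    apply: ler_pM => //.
      apply: le_trans (ler_normD _ _) _; apply: lerD; exact: sumsq_coord.
    by rewrite distrC; apply/ltW/(lt_le_trans (H j)); rewrite ge_min lexx orbT.
  have D0 : 0 < 2 * n%:R + 1 :> R by rewrite ltr_wpDl // mulr_ge0.
  rewrite sumr_const card_ord -mulr_natr /d.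
  rewrite [ltLHS](_ : _ = e ^+ 2 * (2 * n%:R) / (2 * n%:R + 1)); last by ring.
  by rewrite ltr_pdivrMr // ltr_pM2l ?exprn_gt0 // ltrDl.
- move=> x [x1 x0]; rewrite /k -[RHS]cons_drop; congr (cons _ _).
  have H : x ord0 ord0 ^+ 2 + sumsq (drop x) = 1.
    by rewrite -sumsq_cons cons_drop.
  have -> : 1 - sumsq (drop x) = (sg * x ord0 ord0) ^+ 2.
    by rewrite exprMn sg2 mul1r -H; ring.
  by rewrite sqrtr_sqr ger0_norm // mulrA -expr2 sg2 mul1r.
- by move=> y _; apply: drop_cons.
Qed.

(** The common point drops the small first coordinate of [x] and rescales the rest to norm 1; the
    cap 1/2 on the radius keeps the norm [r] of the rest at least 1/2. *)
Let excisive_hemi n : excisive (@hemi n 1) (@hemi n (-1)).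
Proof.
move=> eta eta0; exists (Num.min eta 2^-1); first by rewrite lt_min eta0 invr_gt0 ltr0n.
move=> x y [x1 x0] [y1 y0] /ball_rV[_ H].
set d := Num.min _ _ in H.
have x0d : x ord0 ord0 < d.
  have := le_lt_trans (ler_norm _) (H ord0); lra.
rewrite mul1r in x0.
have d2 : d <= 2^-1 by rewrite ge_min lexx orbT.
have de : d <= eta by rewrite ge_min lexx.
have sx : x ord0 ord0 ^+ 2 + sumsq (drop x) = 1.
  by rewrite -sumsq_cons cons_drop.
set a := x ord0 ord0 in x0d x0 sx.
pose r := Num.sqrt (sumsq (drop x)).
have r2 : r ^+ 2 = sumsq (drop x) by rewrite sqr_sqrtr ?sumsq_ge0.
have r0 : 0 <= r by apply: sqrtr_ge0.
have r12 : 2^-1 <= r by nra.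
have rn0 : r != 0 by rewrite gt_eqF //; lra.
have r1 : r <= 1 by nra.
pose z := cons 0 (r^-1 *: drop x).
have z1 : unit_sphere R n.+1 z.
  rewrite /unit_sphere /= -/(sumsq _) sumsq_cons expr0n add0r /sumsq.
  under eq_bigr do rewrite mxE exprMn.
  by rewrite -mulr_sumr -/(sumsq _) -r2 exprVn mulVf // expf_neq0.
exists z; split; try by split; rewrite // cons0 mulr0.
apply/ball_rV; split=> // i; case: (unliftP ord0 i) => [j|] ->.
  rewrite consS !mxE.
  have xj : `|x ord0 (lift ord0 j)| <= 1.
    by apply: sumsq_coord; rewrite -[x]cons_drop sumsq_cons -sx.
  have -> : x ord0 (lift ord0 j) - r^-1 * x ord0 (lift ord0 j) =
     - (x ord0 (lift ord0 j) * ((1 - r) / r)) by field.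
  rewrite normrN normrM.
  apply: le_lt_trans (_ : (1 - r) / r < _).
    rewrite [X in _ * X]ger0_norm ?divr_ge0 ?subr_ge0 // ler_piMl //.
    by rewrite divr_ge0 ?subr_ge0.
  rewrite ltr_pdivrMr; last by lra.
  nra.
by rewrite cons0 subr0 ger0_norm // (lt_le_trans x0d).
Qed.

(** Two acyclic hemispheres meet in the equator, a copy of the sphere one dimension lower. *)
Lemma unit_sphere_like n : sphere_like F (unit_sphere R n) (odd n).
Proof.
elim: n => [|n IH].
  suff -> : unit_sphere R 0 = set0 by apply: sphere_like_set0.
  rewrite -subset0 => x; rewrite /unit_sphere /= big_ord0 => /esym/eqP.
  by rewrite oner_eq0.
have XE : unit_sphere R n.+1 = (hemi 1 `|` hemi (-1))%classic.
  apply/seteqP; split=> x; last by case=> -[].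
  move=> x1; have [x0|x0] := leP 0 (x ord0 ord0).
    by left; split; rewrite // mul1r.
  by right; split; rewrite // mulN1r oppr_ge0 ltW.
have CE x : (hemi 1 `&` hemi (-1))%classic x ->
    unit_sphere R n.+1 x /\ x ord0 ord0 = 0.
  move=> [[x1 +] [_]]; rewrite mul1r mulN1r oppr_ge0 => x0 x0'.
  by split=> //; apply/eqP; rewrite eq_le x0 x0'.
rewrite XE /=; apply: (@sphere_like_suspension _ _ _ _ _ (@excisive_hemi n)).
- by apply: acyclic_hemi; rewrite sqrrN expr1n.
- have uh : unif_map (hemi 1 `&` hemi (-1))%classic (unit_sphere R n) (@drop n).
    apply: drop_unif => x /CE[x1 x0]; move: x1.
    rewrite -{1}[x]cons_drop x0 /unit_sphere /= -!/(sumsq _) sumsq_cons.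
    by rewrite expr0n add0r.
  have uk : unif_map (unit_sphere R n) (hemi 1 `&` hemi (-1))%classic (@cons n 0).
    split=> [y y1|e e0].
      have S : unit_sphere R n.+1 (cons 0 y).
        by rewrite /unit_sphere /= -!/(sumsq _) sumsq_cons expr0n add0r.
      by split; split; rewrite // cons0 mulr0.
    exists e => // x y _ _ /ball_rV[_ H]; apply/ball_rV; split=> // i.
    case: (unliftP ord0 i) => [j|] ->; first by rewrite !consS.
    by rewrite !cons0 subrr normr0.
  have kh (x : 'rV[R]_n.+1) : (@hemi n 1 `&` @hemi n (-1))%classic x ->
      cons 0 (drop x) = x.
    by move=> /CE[_ x0]; rewrite -{2}[x]cons_drop x0.
  have hk (y : 'rV[R]_n) : unit_sphere R n y -> drop (cons 0 y) = y.
    by rewrite drop_cons.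
  by case: IH => IH1 IH0; split; apply: coh_dim_homeo uh uk kh hk _.
- by apply: acyclic_hemi; rewrite expr1n.
Qed.

End Spheres.

(** * Realizations of simplicial complexes *)

Section CompactHomeomorphisms.
Variable (R : realType).

(** Heine-Cantor relative to [X], by covering compactness with a radius tending to 0 as
    parameter. *)
Lemma compact_unif_map (U V : pseudoMetricType R) (X : set U) (Y : set V) (f : U -> V) :
  compact X -> {within X, continuous f}%classic -> (forall x, X x -> Y (f x)) ->
  unif_map X Y f.
Proof.
move=> /compact_near_coveringP cX /subspace_continuousP fc XY; split=> // eps e0.
have [] := cX R (0^'+)%classic
  (fun d x => forall y, X x -> X y -> ball x d y -> ball (f x) eps (f y)) _ _.
  move=> x Xx.
  have [r r0 H] : exists2 r : R, 0 < r & forall y, X y -> ball x r y ->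
      ball (f x) (eps / 2) (f y).
    have : nbhs (f x) (ball (f x) (eps / 2)) by apply: nbhsx_ballx; rewrite divr_gt0.
    move=> /(fc _ Xx); rewrite /nbhs /= /within /= => /nbhs_ballP[r /= r0 H].
    by exists r => // y Xy /H; apply.
  exists (ball x (r / 2), [set d : R | d < r / 2])%classic => /=.
    by split; [apply: nbhsx_ballx; rewrite divr_gt0|apply: nbhs_right_lt; rewrite divr_gt0].
  move=> [x' d] /= [xx' dr] y Xx' Xy x'y; rewrite (splitr eps).
  apply: ball_triangle (_ : ball (f x') (eps / 2) (f x)) (H _ Xy _).
    apply: ball_sym; apply: H => //; apply: le_ball xx'; lra.
  rewrite (splitr r); apply: ball_triangle xx' _.
  exact: le_ball (ltW dr) _ x'y.
move=> d /= d0 H; exists (d / 2); first by rewrite divr_gt0.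
move=> x y Xx Xy xy.
apply: (H (d / 2)) xy => //=; last by rewrite divr_gt0.
by rewrite sub0r normrN gtr0_norm ?divr_gt0 // ltr_pdivrMr // ltr_pMr // ltr1n.
Qed.

Lemma compact_unit_cube n (X : set 'rV[R]_n) :
  (forall x i, X x -> `|x ord0 i| <= 1) ->
  (forall x, (forall e, 0 < e -> exists2 y, X y & ball x e y) -> X x) ->
  compact X.
Proof.
move=> X1 Xcl.
apply: (@subclosed_compact _ _
  [set v : 'rV[R]_n | forall i, `[(-1 : R), 1] (v ord0 i)]%classic).
- move=> x clx; apply: Xcl => e e0.
  by have [y [Xy xy]] := clx _ (nbhsx_ballx x _ e0); exists y.
- apply: (@rV_compact _ _ (fun=> `[(-1 : R), 1]%classic)) => i.
  exact: segment_compact.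
- by move=> x Xx i /=; rewrite in_itv /= -ler_norml; apply: X1.
Qed.

Lemma eq0_small (a C : R) : (forall e, 0 < e -> e <= 1 -> `|a| <= C * e) -> a = 0.
Proof.
move=> H; apply/eqP; apply: contraT => a0.
have na : 0 < `|a| by rewrite normr_gt0.
have C0 : 0 < C by have := H 1 ltr01 (lexx _); lra.
pose e := Num.min 1 (`|a| / (2 * C)).
have e0 : 0 < e by rewrite lt_min ltr01 divr_gt0 // mulr_gt0.
have e1 : e <= 1 by rewrite ge_min lexx.
have aCe := H e e0 e1.
have : C * e <= C * (`|a| / (2 * C)) by apply: ler_wpM2l; [exact: ltW|rewrite /e ge_min lexx orbT].
rewrite [C * (_ / _)](_ : _ = `|a| / 2); last by field; rewrite gt_eqF.
by lra.
Qed.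

Lemma compact_unit_sphere n : compact (unit_sphere R n).
Proof.
apply: compact_unit_cube.
  move=> x i; rewrite /unit_sphere /= => x1; rewrite -(@expr_le1 _ 2) //.
  rewrite -normrX ger0_norm ?sqr_ge0 // -x1 (bigD1 i) //= lerDl.
  by apply: sumr_ge0 => j _; apply: sqr_ge0.
move=> x H; rewrite /unit_sphere /=; apply/eqP; rewrite -subr_eq0; apply/eqP.
apply: (@eq0_small _ (\sum_(i < n) (2 * `|x ord0 i| + 1))) => e e0 e1.
have [y y1 /ball_rV[_ xy]] := H _ e0.
rewrite -{1}y1 -sumrB mulr_suml.
apply: le_trans (ler_norm_sum _ _ _) _; apply: ler_sum => i _.
rewrite subr_sqr normrM mulrC; apply: ler_pM => //; last exact: ltW.
have -> : x ord0 i + y ord0 i = 2 * x ord0 i - (x ord0 i - y ord0 i) by ring.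
apply: le_trans (ler_normB _ _) _; rewrite normrM normr_nat.
by have := xy i; lra.
Qed.

Variable T : finType.
Implicit Types (K L : {set {set T}}) (C D : {set T}) (x : 'rV[R]_#|T|).

Definition simplicial K :=
  forall C D, C \in K -> D \subset C -> D != finset.set0 -> D \in K.

Let supp x : {set T} := [set t | x ord0 (enum_rank t) != 0]%SET.

Let supp_neq0 x : \sum_i x ord0 i = 1 -> supp x != finset.set0.
Proof.
move=> x1; apply: contraTneq isT => s0.
have x0 i : x ord0 i = 0.
  apply/eqP; have : enum_val i \notin supp x by rewrite s0 inE.
  by rewrite inE negbK enum_valK.
by move: x1; rewrite big1 // => /esym/eqP; rewrite oner_eq0.
Qed.

Let coord_le1 K x i : realization R K x -> `|x ord0 i| <= 1.
Proof.
case=> x0 x1 _; rewrite ger0_norm // -x1 (bigD1 i) //= lerDl.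
exact: sumr_ge0.
Qed.

Lemma compact_realization K : simplicial K -> compact (realization R K).
Proof.
move=> sK; apply: compact_unit_cube => [x i|x H]; first exact: coord_le1.
have x0 i : 0 <= x ord0 i.
  rewrite leNgt; apply/negP => xi.
  have [|y [y0 _ _] /ball_rV[_ /(_ i)]] := H (- x ord0 i); first by rewrite oppr_gt0.
  by rewrite distrC => /(le_lt_trans (ler_norm _)); have := y0 i; lra.
have x1 : \sum_i x ord0 i = 1.
  apply/eqP; rewrite -subr_eq0; apply/eqP.
  apply: (@eq0_small _ #|T|%:R) => e e0 _.
  have [y [_ y1 _] /ball_rV[_ xy]] := H _ e0.
  rewrite -{1}y1 -sumrB; apply: le_trans (ler_norm_sum _ _ _) _.
  apply: le_trans (_ : \sum_(i < #|T|) e <= _).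
    by apply: ler_sum => i _; apply/ltW.
  by rewrite sumr_const card_ord mulr_natl.
(* Within the smallest nonzero coordinate of [x], a point [y] of the realization cannot vanish where
   [x] does not, so the support of [x] is a face of that of [y]. *)
split=> //; pose e := \big[Num.min/1]_(i | x ord0 i != 0) `|x ord0 i|.
have e0 : 0 < e by apply/bigmin_gtP; split=> // i; rewrite normr_gt0.
have [y [y0 y1 yK] /ball_rV[_ xy]] := H _ e0.
apply: sK yK _ (supp_neq0 x1); apply/fintype.subsetP => t; rewrite !inE => xt.
apply: contraTneq (xy (enum_rank t)) => ->.
by rewrite subr0 -leNgt /e; apply: bigmin_le_cond.
Qed.

(** The common point is the coordinatewise minimum of [x] and [y], normalized to mass 1: its support
    lies in both simplices. *)
Lemma excisive_realization K L : simplicial K -> simplicial L ->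
  excisive (realization R K) (realization R L).
Proof.
(* The minimum loses at most [#|T|%:R * d] of mass, and a coordinate moves by at most one [d] more;
   the last [d] makes inequalities strict. *)
move=> sK sL eta eta0; pose N : R := #|T|%:R + 2.
have N0 : 0 < N by rewrite ltr_wpDl.
pose d := Num.min eta 1 / N.
have d0 : 0 < d by rewrite divr_gt0 // lt_min eta0 ltr01.
have dN : N * d = Num.min eta 1 by rewrite /d mulrC divfK // gt_eqF.
have Nd1 : N * d <= 1 by rewrite dN ge_min lexx orbT.
have Nde : N * d <= eta by rewrite dN ge_min lexx.
exists d => // x y [x0 x1 xK] [y0 y1 yL] /ball_rV[_ xy].
pose m i := Num.min (x ord0 i) (y ord0 i).
have m0 i : 0 <= m i by rewrite le_min x0 y0.
have mx i : x ord0 i - m i <= d.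
  rewrite /m minEle; case: ifP => _; first by rewrite subrr; exact: ltW.
  exact: le_trans (ler_norm _) (ltW (xy i)).
have mle i : m i <= x ord0 i by rewrite ge_min lexx.
pose s := \sum_i m i.
have s1 : 1 - s <= #|T|%:R * d.
  rewrite -{1}x1 /s -sumrB; apply: le_trans (_ : \sum_(i < #|T|) d <= _).
    exact: ler_sum.
  by rewrite sumr_const card_ord mulr_natl.
have s0 : 0 < s by move: s1 Nd1; rewrite /N; lra.
have sn0 : s != 0 by rewrite gt_eqF.
have sle1 : s <= 1 by rewrite -x1; apply: ler_sum.
pose z : 'rV[R]_#|T| := \row_i (m i / s).
have z0 i : 0 <= z ord0 i by rewrite mxE divr_ge0 // ltW.
have z1 : \sum_i z ord0 i = 1.
  by under eq_bigr do rewrite mxE; rewrite -mulr_suml divff.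
have zx : supp z \subset supp x.
  apply/fintype.subsetP => t; rewrite !inE mxE mulf_eq0 invr_eq0 (negbTE sn0) orbF.
  apply: contraNneq => xt; rewrite eq_le m0 andbT.
  by rewrite (le_trans (mle _)) // xt.
have zy : supp z \subset supp y.
  apply/fintype.subsetP => t; rewrite !inE mxE mulf_eq0 invr_eq0 (negbTE sn0) orbF.
  apply: contraNneq => yt; rewrite eq_le m0 andbT.
  by rewrite /m yt ge_min lexx orbT.
exists z; split.
- by split=> //; apply: sK xK zx (supp_neq0 z1).
- by split=> //; apply: sL yL zy (supp_neq0 z1).
apply/ball_rV; split=> // i; rewrite mxE.
have -> : x ord0 i - m i / s = (x ord0 i - m i) - (1 - s) * (m i / s) by field.
apply: le_lt_trans (ler_normB _ _) _.
have mis : 0 <= m i / s <= 1.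
  apply/andP; split; first by apply: divr_ge0 => //; apply: ltW.
  rewrite ler_pdivrMr // mul1r /s (bigD1 i) //= lerDl.
  exact: sumr_ge0.
have /andP[ms0 ms1] := mis.
have p0 : 0 <= (1 - s) * (m i / s) by rewrite mulr_ge0 // subr_ge0.
rewrite (ger0_norm p0) ger0_norm ?subr_ge0 //.
have p1 : (1 - s) * (m i / s) <= 1 - s by rewrite ler_piMr // subr_ge0.
by have := mx i; move: s1 Nde; rewrite /N; lra.
Qed.

Lemma homeomorphic_sphere_like (F : fieldType) K n : simplicial K ->
  homeomorphic (realization R K) (unit_sphere R n) ->
  sphere_like F (realization R K) (odd n).
Proof.
move=> sK [f [g [fc gc fg gf]]].
have uf : unif_map (realization R K) (unit_sphere R n) f.
  by apply: compact_unif_map (compact_realization sK) fc _ => x /fg[].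
have ug : unif_map (unit_sphere R n) (realization R K) g.
  by apply: compact_unif_map (@compact_unit_sphere n) gc _ => y /gf[].
have gfK x : realization R K x -> g (f x) = x by case/fg.
have fgK w : unit_sphere R n w -> f (g w) = w by case/gf.
have [S1 S0] := unit_sphere_like R F n.
by split; apply: coh_dim_homeo uf ug gfK fgK _.
Qed.

Lemma realizationU K L :
  realization R (K :|: L) = (realization R K `|` realization R L)%classic.
Proof.
apply/seteqP; split=> x.
  by case=> x0 x1; rewrite finset.in_setU => /orP[xK|xL]; [left|right].
by case=> -[x0 x1 xK]; split; rewrite // finset.in_setU xK ?orbT.
Qed.

Lemma realizationI K L :
  realization R (K :&: L) = (realization R K `&` realization R L)%classic.
Proof.
apply/seteqP; split=> x.
  by case=> x0 x1; rewrite finset.in_setI => /andP[xK xL]; split.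
by case=> -[x0 x1 xK] [_ _ xL]; split; rewrite // finset.in_setI xK xL.
Qed.

Definition vertex (a : T) : 'rV[R]_#|T| := \row_i (i == enum_rank a)%:R.

Lemma realization_vertex K (a : T) : [set a]%SET \in K -> realization R K (vertex a).
Proof.
move=> aK; split.
- by move=> i; rewrite mxE ler0n.
- under eq_bigr do rewrite mxE.
  by rewrite (bigD1 (enum_rank a)) //= eqxx big1 ?addr0 // => i /negbTE->.
suff -> : [set t | vertex a ord0 (enum_rank t) != 0]%SET = [set a]%SET by [].
apply/setP => t; rewrite !inE mxE (inj_eq enum_rank_inj).
by rewrite pnatr_eq0 eqb0 negbK.
Qed.

Lemma acyclic_cone (F : fieldType) K (a : T) : simplicial K -> [set a]%SET \in K ->
  (forall C, C \in K -> (a |: C) \in K) -> acyclic F (realization R K).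
Proof.
move=> sK aK cone; pose c := vertex a.
have cK := realization_vertex aK; have [c0 c1 _] := cK.
apply: (@acyclic_star _ _ _ _ c 2 cK) => [x i xK|x t xK /andP[t0 t1]].
  have := coord_le1 i xK; have := coord_le1 i cK => ci xi.
  by apply: le_trans (ler_normB _ _) _; lra.
case: (xK) => x0 x1 xsK.
have E i : (c + t *: (x - c)) ord0 i = (1 - t) * c ord0 i + t * x ord0 i.
  by rewrite /c !mxE; ring.
have y1 : \sum_i (c + t *: (x - c)) ord0 i = 1.
  under eq_bigr do rewrite E; rewrite big_split /= -!mulr_sumr x1 c1; ring.
split=> // [i|]; first by rewrite E addr_ge0 // mulr_ge0 ?subr_ge0.
apply: sK (cone _ xsK) _ (supp_neq0 y1); apply/fintype.subsetP => u.
rewrite !inE E; apply: contraR; rewrite negb_or negbK => /andP[ua /eqP->].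
by rewrite mxE (inj_eq enum_rank_inj) (negbTE ua) !mulr0 addr0.
Qed.

End CompactHomeomorphisms.

(** * Euler characteristics in CW posets *)

Section CWPosets.
Variables (d : Order.disp_t) (T : finPOrderType d).
Implicit Types (P Q C D : {set T}) (a b x y : T).

Lemma chainP C : reflect {in C &, forall x y, (x >=< y)%O} (is_chain C).
Proof.
apply: (iffP forallP) => [H x y xC yC|H x].
  by have := H x; rewrite xC /= => /forallP/(_ y); rewrite yC.
by apply/implyP => xC; apply/forallP => y; apply/implyP; apply: H.
Qed.

Lemma chainS C D : D \subset C -> is_chain C -> is_chain D.
Proof.
move=> /fintype.subsetP DC /chainP cC; apply/chainP => x y /DC xC /DC; exact: cC.
Qed.

Lemma mem_order_complex P C :
  (C \in order_complex P) = [&& C \subset P, is_chain C & C != finset.set0].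
Proof. by rewrite inE. Qed.

Lemma simplicial_order_complex P : simplicial (order_complex P).
Proof.
move=> C D; rewrite !mem_order_complex => /and3P[CP cC _] DC D0.
by rewrite (fintype.subset_trans DC CP) (chainS DC cC) D0.
Qed.

Lemma lower_cone P a : a \in P ->
  [set a]%SET \in order_complex (lower P a) /\
  forall C, C \in order_complex (lower P a) -> (a |: C) \in order_complex (lower P a).
Proof.
move=> aP; have aL : a \in lower P a by rewrite inE aP lexx.
split=> [|C]; rewrite !mem_order_complex.
  rewrite finset.sub1set aL /=; apply/andP; split; last by apply/finset.set0Pn; exists a; rewrite inE.
  by apply/chainP => x y; rewrite !inE => /eqP-> /eqP->; apply: comparablexx.
move=> /and3P[CL /chainP cC _]; apply/and3P; split.
- by rewrite finset.subUset finset.sub1set aL.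
- have Ca x : x \in C -> (x <= a)%O by move=> /(fintype.subsetP CL); rewrite inE => /andP[].
  apply/chainP => x y; rewrite !inE => /orP[/eqP->|xC] /orP[/eqP->|yC].
  + exact: comparablexx.
  + by rewrite comparable_sym /Order.comparable Ca.
  + by rewrite /Order.comparable Ca.
  + exact: cC.
- by apply/finset.set0Pn; exists a; rewrite !inE eqxx.
Qed.

(** As [Q] is a down-set, a chain through [a] in [a |: Q] lies entirely below [a]. *)
Lemma order_complex_attach P Q a : Q \subset P -> a \in P -> a \notin Q ->
  (forall x y, x \in P -> y \in Q -> (x <= y)%O -> x \in Q) ->
  strict_lower P a \subset Q ->
  order_complex (a |: Q) = order_complex Q :|: order_complex (lower P a) /\
  order_complex Q :&: order_complex (lower P a) = order_complex (strict_lower P a).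
Proof.
move=> QP aP aQ lowQ /fintype.subsetP sQ; split; apply/setP => C.
  rewrite finset.in_setU !mem_order_complex.
  case cC: (is_chain C); case C0: (C == finset.set0); rewrite ?andbF //= !andbT.
  apply/idP/orP => [/fintype.subsetP CaQ|[CQ|CL]].
  - have [aC|aC] := boolP (a \in C).
      right; apply/fintype.subsetP => x xC; rewrite inE.
      have := CaQ _ xC; rewrite !inE => /orP[/eqP->|xQ]; first by rewrite aP lexx.
      rewrite (fintype.subsetP QP) //=.
      have /chainP/(_ _ _ xC aC)/orP[//|ax] := cC.
      by rewrite (lowQ _ _ aP xQ ax) in aQ.
    left; apply/fintype.subsetP => x xC; have := CaQ _ xC; rewrite !inE.
    by case/predU1P => [xa|//]; rewrite -xa xC in aC.
  - exact: fintype.subset_trans CQ (finset.subsetUr _ _).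
  - apply: fintype.subset_trans CL _; apply/fintype.subsetP => x; rewrite !inE => /andP[xP].
    by rewrite le_eqVlt => /predU1P[->|xa]; rewrite ?eqxx // sQ ?orbT // inE xP.
rewrite finset.in_setI !mem_order_complex.
case: (is_chain C); case: (C != finset.set0); rewrite ?andbF ?andbT //=.
apply/andP/idP => [[/fintype.subsetP CQ /fintype.subsetP CL]|CL].
  apply/fintype.subsetP => x xC; have := CL _ xC; rewrite !inE => /andP[-> xa].
  by rewrite lt_neqAle xa andbT; apply: contraNneq aQ => <-; apply: CQ.
split; apply: fintype.subset_trans CL _; first exact/fintype.subsetP.
by apply/fintype.subsetP => x; rewrite !inE => /andP[-> /ltW].
Qed.

(** Removing a maximal element [a] of [Q] detaches a cone along the sphere of [strict_lower P a].
    The value is minus the reduced Euler characteristic, hence 1 for the empty complex. *)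
Lemma CW_lower_euler (R : realType) P : CW_poset R P -> forall Q, Q \subset P ->
  (forall x y, x \in P -> y \in Q -> (x <= y)%O -> x \in Q) ->
  has_euler rat (realization R (order_complex Q))
    (1 - \sum_(a in Q) (-1) ^+ Defs.dim (order_complex (lower P a))).
Proof.
move=> [_ cw] Q; elim: {Q}#|Q| {-2}Q (leqnn #|Q|) => [|n IH] Q Qn QP lowQ.
  have -> : Q = finset.set0 by apply/eqP; rewrite -cards_eq0 -leqn0.
  rewrite big_set0 subr0.
  suff -> : realization R (order_complex (finset.set0 : {set T})) = classical_sets.set0.
    exact: (sphere_like_euler (sphere_like_set0 rat _)).
  rewrite -subset0 => x [_ _]; rewrite mem_order_complex => /and3P[].
  by rewrite finset.subset0 => ->.
have [->|/finset.set0Pn[a0 a0Q]] := eqVneq Q finset.set0.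
  by apply: IH; rewrite ?cards0 ?finset.sub0set // => x y; rewrite inE.
have [a aQ amax] : exists2 a, a \in Q & forall x, x \in Q -> ~~ (a < x)%O.
  pose h x := #|lower Q x|.
  have [a aQ hmax] := arg_maxnP h a0Q.
  exists a => // x xQ; apply/negP => ax.
  have : (h x <= h a)%N := hmax x xQ; rewrite leqNgt => /negP; apply; apply: proper_card.
  apply/properP; split.
    by apply/fintype.subsetP => y; rewrite !inE => /andP[-> /le_trans]; apply; apply: ltW.
  by exists x; rewrite !inE xQ ?lexx //= lt_geF.
pose Q' := Q :\ a.
have QE : Q = a |: Q' by rewrite /Q' finset.setD1K.
have aP : a \in P by apply: (fintype.subsetP QP).
have Q'P : Q' \subset P by apply: fintype.subset_trans QP; apply: finset.subsetDl.
have aQ' : a \notin Q' by rewrite !inE eqxx.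
have lowQ' x y : x \in P -> y \in Q' -> (x <= y)%O -> x \in Q'.
  rewrite !inE => xP /andP[ya yQ] xy; rewrite (lowQ _ _ xP yQ xy) andbT.
  apply: contraNneq (amax _ yQ) => xa; rewrite lt_neqAle eq_sym ya.
  by rewrite -xa.
have sQ' : strict_lower P a \subset Q'.
  apply/fintype.subsetP => x; rewrite !inE => /andP[xP xa].
  by rewrite lt_eqF // (lowQ _ _ xP aQ (ltW xa)).
have [EU EI] := order_complex_attach Q'P aP aQ' lowQ' sQ'.
rewrite {1}QE EU realizationU [in \sum_(_ in Q) _]QE big_setU1 //=.
rewrite opprD addrCA addrC -signr_odd.
have [aL coneL] := lower_cone aP.
apply: has_euler_attach.
- exact: excisive_realization (@simplicial_order_complex _) (@simplicial_order_complex _).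
- exact: acyclic_cone (@simplicial_order_complex _) aL coneL.
- rewrite -realizationI EI.
  exact: homeomorphic_sphere_like (@simplicial_order_complex _) (cw _ aP).
apply: IH => //; move: Qn; rewrite {1}QE cardsU1 aQ'.
by rewrite add1n ltnS.
Qed.

(** The boundary of the cell is evaluated twice, as a sphere and as a down-set; their equality
    supplies the term of [b]. *)
Lemma CW_cell_euler (R : realType) P b : CW_poset R P -> b \in P ->
  \sum_(a in lower P b) (-1) ^+ Defs.dim (order_complex (lower P a)) = 1%R :> int.
Proof.
move=> cw bP.
have SP : strict_lower P b \subset P.
  by apply/fintype.subsetP => x; rewrite inE => /andP[].
have low x y : x \in P -> y \in strict_lower P b -> (x <= y)%O ->
    x \in strict_lower P b.
  by rewrite !inE => -> /andP[_ yb] xy; rewrite (le_lt_trans xy).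
have E1 := CW_lower_euler cw SP low.
have E2 := sphere_like_euler (homeomorphic_sphere_like rat
  (@simplicial_order_complex _) (cw.2 _ bP)).
have := has_euler_inj E2 E1; rewrite signr_odd => E.
have -> : lower P b = b |: strict_lower P b.
  apply/setP => x; rewrite !inE le_eqVlt.
  by case: eqVneq => [->|_] //=; rewrite ?bP.
rewrite big_setU1 /= ?inE ?ltxx ?andbF // E; exact: subrK.
Qed.

End CWPosets.

(** * Units in the algebra of a connected band *)

Section ConnectedPosets.
Variables (R : realType) (d : Order.disp_t) (T : finPOrderType d).
Implicit Types (P C : {set T}).

Lemma connected_constant (I : eqType) P (f : T -> I) :
  connected (realization R (order_complex P)) ->
  (forall a b, a \in P -> b \in P -> (a <= b)%O -> f a = f b) ->
  forall a b, a \in P -> b \in P -> f a = f b.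
Proof.
move=> conn fle a b aP bP.
have vtx t : t \in P -> realization R (order_complex P) (vertex R t).
  move=> tP; apply: realization_vertex; rewrite mem_order_complex.
  rewrite finset.sub1set tP /=; apply/andP; split; last first.
    by apply/finset.set0Pn; exists t; rewrite inE.
  by apply/chainP => x y; rewrite !inE => /eqP-> /eqP->; apply: comparablexx.
(* The barycentric mass of the vertices where [f] takes the value [f b]; it is
   0 or 1 on every simplex. *)
pose phi (x : 'rV[R]_#|T|) := \sum_(t | f t == f b) x ord0 (enum_rank t).
have phi_cont : continuous phi.
  apply: continuous_big => [|t _]; first exact: add_continuous.
  exact: coord_continuous.
have phi_vtx t : phi (vertex R t) = (f t == f b)%:R.
  rewrite /phi; under eq_bigr do rewrite mxE (inj_eq enum_rank_inj).
  case: (boolP (f t == f b)) => ft.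
    by rewrite (bigD1 t) //= eqxx big1 ?addr0 // => u /andP[_ /negbTE->].
  by rewrite big1 // => u fu; case: eqP => // ut; rewrite -ut fu in ft.
have phi01 x : realization R (order_complex P) x -> phi x = 0 \/ phi x = 1.
  case=> x0 x1; set C := [set t | _]%SET; rewrite mem_order_complex.
  move=> /and3P[/fintype.subsetP CP /chainP cC _].
  have fC t u : t \in C -> u \in C -> f t = f u.
    move=> tC uC; have /orP[le|le] := cC _ _ tC uC.
      by apply: fle; rewrite ?CP.
    by apply/esym/fle; rewrite ?CP.
  have [[u /andP[uC /eqP fu]]|nC] :=
      pselect (exists u, (u \in C) && (f u == f b)); [right|left].
    rewrite -x1 /phi (reindex enum_rank) /=; last exact/onW_bij/enum_rank_bij.
    rewrite [RHS](bigID (fun t => f t == f b)) /= [X in _ + X]big1 ?addr0 //.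
    move=> t ft; apply/eqP; apply: contraNT ft => xt.
    by rewrite (fC t u) ?fu //; rewrite inE.
  rewrite /phi big1 // => t ft; apply/eqP/negPn/negP => xt.
  by apply: nC; exists t; rewrite ft inE xt.
(* As [phi] takes only the values 0 and 1, the strict and the large cut at 1/2 agree, so [V] is
   relatively open and closed. *)
pose V := (realization R (order_complex P) `&` (phi @^-1` [set r | 2^-1 < r]))%classic.
have VE : V = realization R (order_complex P).
  apply: conn.
  - by exists (vertex R b); split; [exact: vtx|rewrite /= phi_vtx eqxx mulr1n invf_lt1 // ltr1n].
  - exists (phi @^-1` [set r | 2^-1 < r])%classic => //.
    by apply: open_comp => [x _|]; [exact: phi_cont|exact: open_gt].
  - exists (phi @^-1` [set r | 2^-1 <= r])%classic.
      by apply: preimage_closed => [x _|]; [exact: phi_cont|exact: closed_ge].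
    apply/seteqP; split=> x [xK /=]; first by move=> /ltW.
    move=> h; split=> //=; have [x0|x1] := phi01 _ xK.
      by move: h; rewrite x0 leNgt invr_gt0 ltr0n.
    by rewrite x1 invf_lt1 // ltr1n.
have : V (vertex R a) by rewrite VE; apply: vtx.
case=> _ /=; rewrite phi_vtx; case: eqP => // _.
by rewrite ltNge invr_ge0 ler0n.
Qed.

End ConnectedPosets.

(** * Supports and order in a left regular band *)

Section BandBasics.
Variables (d : Order.disp_t) (B : lrbType d).
Implicit Types (a b c x y : B) (X Y : {set B}).
Local Open Scope group_scope.

Lemma supp_leP a b : reflect (a * b = a) (supp a <= supp b)%O.
Proof.
apply: (iffP idP) => [ab|ab].
  apply/eqP; rewrite -mem_supp; apply: (fintype.subsetP ab).
  by rewrite mem_supp lrb_idem.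
apply/fintype.subsetP => c; rewrite !mem_supp => /eqP ca.
by rewrite -{1}ca -mulgA ab ca.
Qed.

Lemma leP_mul a b : reflect (b * a = a) (a <= b)%O.
Proof. by rewrite lrb_leE; apply: eqP. Qed.

Lemma mul_le a b : (a * b <= a)%O.
Proof. by apply/leP_mul; rewrite mulgA lrb_idem. Qed.

Lemma supp_homo a b : (a <= b)%O -> (supp a <= supp b)%O.
Proof. by move=> /leP_mul ab; rewrite -ab suppM leIl. Qed.

Lemma supp_inj_le a b : (a <= b)%O -> supp a = supp b -> a = b.
Proof.
move=> /leP_mul ab E; rewrite -ab; apply/supp_leP.
by rewrite E.
Qed.

Lemma supp_homo_lt a b : (a < b)%O -> (supp a < supp b)%O.
Proof.
move=> ab; have le_ab := ltW ab; rewrite lt_neqAle supp_homo // andbT.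
by apply: contraTneq ab => /(supp_inj_le le_ab)->; rewrite ltxx.
Qed.

Lemma mem_upper X b : (b \in upper X) = (X <= supp b)%O.
Proof. by rewrite inE. Qed.

Lemma upperM X a b : a \in upper X -> b \in upper X -> a * b \in upper X.
Proof. by rewrite !mem_upper suppM lexI => -> ->. Qed.

Lemma mem_Lambda a : supp a \in Lambda B.
Proof. exact: imset_f. Qed.

Lemma LambdaP X : reflect (exists a, X = supp a) (X \in Lambda B).
Proof.
by apply: (iffP imsetP) => [[a _ ->]|[a ->]]; exists a.
Qed.

End BandBasics.

Section UnitalBandAlgebra.
Variables (d : Order.disp_t) (B : lrbType d) (P : {set B}).
Implicit Types (a b c x y : B) (e f g : B -> int) (s : seq B).

Hypothesis PM : forall a b, a \in P -> b \in P -> (a * b)%g \in P.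

(* [e] stands for the element [1 - \prod_(z <- s) (1 - z)] of the algebra of the
   band, which is a right unit on [s] because [x w x = x w]. *)
Lemma band_right_unit : exists e, forall x g, x \in P ->
  \sum_(y in P) e y * g (x * y)%g = g x.
Proof.
suff H s : {subset s <= P} -> exists e, forall x g, x \in s ->
    \sum_(y in P) e y * g (x * y)%g = g x.
  have [|e eP] := H (enum P); first by move=> x; rewrite mem_enum.
  by exists e => x g xP; apply: eP; rewrite mem_enum.
elim: s => [|z s IH] sP; first by exists (fun=> 0).
have [|e eE] := IH; first by move=> x xs; apply: sP; rewrite inE xs orbT.
have zP : z \in P by apply: sP; rewrite mem_head.
(* Coefficients of [e + z - e z], that is, of [1 - (1 - e) (1 - z)]. *)
pose e' y := e y + (y == z)%:Z - \sum_(u in P | (u * z)%g == y) e u.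
exists e' => x g xzs.
have e'E h : \sum_(y in P) e' y * h y =
    \sum_(y in P) e y * h y + h z - \sum_(y in P) e y * h (y * z)%g.
  under eq_bigr do rewrite mulrBl mulrDl.
  rewrite sumrB big_split /=; congr (_ + _ - _).
    rewrite (bigD1 z) //= eqxx mul1r big1 ?addr0 // => y /andP[_ /negbTE->].
    by rewrite mul0r.
  under eq_bigr do rewrite mulr_suml.
  rewrite (exchange_big_dep (mem P)) /=; last by move=> y u _ /andP[].
  apply: eq_bigr => u uP; rewrite (bigD1 (u * z)%g) /=; last by rewrite PM ?uP /=.
  by rewrite big1 ?addr0 // => y /andP[/andP[_ /andP[_ /eqP->]]]; rewrite eqxx.
rewrite e'E; move: xzs; rewrite inE => /predU1P[->|xs].
  under [X in _ - X]eq_bigr do rewrite mulgA lrb_regular.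
  by rewrite lrb_idem addrAC subrr add0r.
under [X in _ - X]eq_bigr do rewrite mulgA.
by rewrite (eE x g xs) (eE x (fun y => g (y * z)%g) xs) addrK.
Qed.

Hypothesis conn : forall c f, c \in P ->
  (forall a b, a \in upper (supp c) -> b \in upper (supp c) -> (a <= b)%O -> f a = f b) ->
  forall a b, a \in upper (supp c) -> b \in upper (supp c) -> f a = f b.

Hypothesis Pup : forall a b, a \in P -> (supp a <= supp b)%O -> b \in P.

Variable e : B -> int.
Hypothesis eR : forall x g, x \in P -> \sum_(y in P) e y * g (x * y)%g = g x.

Let ann f := [set b in P | [forall (c | c \in P), f (c * b)%g == 0]]%SET.

Let annP f b : reflect (b \in P /\ forall c, c \in P -> f (c * b)%g = 0) (b \in ann f).
Proof.
rewrite inE; apply: (iffP andP) => [[bP /forall_inP H]|[bP H]]; split=> //.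
  by move=> c cP; apply/eqP/H.
by apply/forall_inP => c cP; apply/eqP/H.
Qed.

(* A nonzero [f] on which every right translation acts as 0 or as the identity
   is supported on some [upper (supp b)], where it is constant by connectedness;
   hence left multiplication by [e] fixes it. *)
Let translation_fixed_eq0 f :
  (forall c, c \in P -> \sum_(y in P) e y * f (y * c)%g = 0) ->
  (forall b, b \in P -> b \notin ann f -> forall c, c \in P -> f (c * b)%g = f c) ->
  forall c, c \in P -> f c = 0.
Proof.
move=> f0 f_fix c0 c0P; apply/eqP/negPn/negP => /eqP fc0.
pose S := [set b in P | b \notin ann f]%SET.
have SP b : b \in S -> b \in P by rewrite inE => /andP[].
have Sfix b c : b \in S -> c \in P -> f (c * b)%g = f c.
  by rewrite inE => /andP[bP nb]; apply: f_fix.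
have Sintro b : b \in P -> (forall c, c \in P -> f (c * b)%g = f c) -> b \in S.
  move=> bP H; rewrite inE bP; apply/annP => -[_ /(_ _ c0P)].
  by rewrite H.
have c0S : c0 \in S.
  by rewrite inE c0P; apply/annP => -[_ /(_ _ c0P)]; rewrite lrb_idem.
(* [S] is closed under products, so an element of smallest support cuts out all of [S]. *)
have [b0 b0S b0min] := @arg_minnP _ c0 (mem S) (fun b => #|supp b|) c0S.
have {}b0S : b0 \in S := b0S.
have b0P := SP _ b0S.
have SE b : b \in P -> (b \in S) = (supp b0 <= supp b)%O.
  move=> bP; apply/idP/idP => [bS|le].
    have bbS : (b * b0)%g \in S.
      apply: Sintro => [|c cP]; first exact: PM.
      by rewrite mulgA Sfix ?PM // Sfix.
    have := b0min _ bbS; rewrite suppM => min.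
    have : (supp b `&` supp b0)%O == supp b0.
      by rewrite eqEcard min andbT; apply: finset.subsetIr.
    by move=> /eqP/meet_idPr.
  rewrite inE bP; apply/annP => -[_ H]; apply: fc0.
  rewrite -(Sfix _ _ b0S c0P).
  have /supp_leP <- := le; rewrite mulgA; apply: H; exact: PM.
have up b : b \in upper (supp b0) -> b \in S.
  by rewrite mem_upper => le; rewrite SE // (Pup b0P).
have const b : b \in S -> f b = f b0.
  move=> bS; apply: (conn b0P (f := f)); rewrite ?mem_upper ?lexx // -?SE ?SP //.
  move=> x y xU yU /leP_mul <-.
  by rewrite Sfix ?up // SP ?up.
have off b : b \in P -> b \notin S -> f b = 0.
  move=> bP; rewrite inE bP negbK => /annP[_ /(_ _ bP)].
  by rewrite lrb_idem.
(* [y * b0] and [b0 * y] have the same support, which turns the left action of [e] into its right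
   unit property at [b0]. *)
have fE y : y \in P -> f (y * b0)%g = f b0 * (b0 * y \in S)%g%:Z.
  move=> yP; have ybP := PM yP b0P; have byP := PM b0P yP.
  have E : ((y * b0)%g \in S) = ((b0 * y)%g \in S).
    by rewrite !SE // !suppM meetC.
  case: (boolP ((b0 * y)%g \in S)) => bS; rewrite ?mulr1 ?mulr0.
    by apply: const; rewrite E.
  by apply: off; rewrite ?E.
have : f b0 = 0.
  rewrite -[RHS](f0 _ b0P).
  under [RHS]eq_bigr => y yP do rewrite fE //.
  by rewrite (eR (fun z => f b0 * (z \in S)%:Z) b0P) b0S mulr1.
by move=> fb0; apply: fc0; rewrite const.
Qed.

(** Induction on the number of [b] not annihilating [f]: [f (_ * b) - f] is annihilated by [b], by
    idempotence, and by all that annihilates [f], by regularity. So it vanishes, and the previous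
    case applies. *)
Let left_annihilated_eq0 f :
  (forall c, c \in P -> \sum_(y in P) e y * f (y * c)%g = 0) ->
  forall c, c \in P -> f c = 0.
Proof.
elim: {f}#|P :\: ann f| {-2}f (leqnn #|P :\: ann f|) => [|n IH] f fn f0.
  apply: translation_fixed_eq0 => // b bP nb.
  have : b \in P :\: ann f by rewrite inE nb.
  by move: fn; rewrite leqn0 cards_eq0 => /eqP->; rewrite inE.
apply: translation_fixed_eq0 => // b bP nb.
pose g c := f (c * b)%g - f c.
suff g0 c : c \in P -> g c = 0.
  by move=> c cP; apply/eqP; rewrite -subr_eq0; apply/eqP/g0.
apply: IH => [|{}c cP]; last first.
  under eq_bigr do rewrite /g mulrBr -mulgA.
  by rewrite sumrB !f0 ?subrr // PM.
rewrite -ltnS; apply: leq_trans fn; apply: proper_card; apply/properP; split.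
  apply: finset.setDS; apply/fintype.subsetP => x /annP[xP fx]; apply/annP.
  split=> // {}c cP; rewrite /g fx // subr0 -mulgA -(lrb_regular x b) mulgA.
  by apply: fx; rewrite !PM.
exists b; first by rewrite inE nb.
rewrite inE negb_and negbK; apply/orP; left; apply/annP; split=> // {}c cP.
by rewrite /g -mulgA lrb_idem subrr.
Qed.

(** The defect [g - e g] is killed by [e], since a right unit is idempotent. *)
Lemma band_left_unit g c : c \in P -> \sum_(y in P) e y * g (y * c)%g = g c.
Proof.
move=> cP; apply/esym/eqP; rewrite -subr_eq0; apply/eqP.
apply: (left_annihilated_eq0 (f := fun c => g c - \sum_(y in P) e y * g (y * c)%g)) cP.
move=> {}c cP; under eq_bigr do rewrite mulrBr mulr_sumr.
rewrite sumrB exchange_big /=; apply/eqP; rewrite subr_eq0; apply/eqP.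
apply: eq_bigr => u uP.
rewrite -(eR (fun z => g (z * c)%g) uP) mulr_sumr.
by apply: eq_bigr => y yP; rewrite mulgA mulrCA.
Qed.

End UnitalBandAlgebra.

Section Euler.
Variables (R : realType) (d : Order.disp_t) (B : lrbType d).
Hypotheses (connB : connected_lrb B R) (cwB : CW_lrb B R).

(* Double counting of the pairs [a <= y] weighted by the coefficient of [y] in
   the unit and the sign of [a]. *)
Lemma band_euler (X : {set B}) : X \in Lambda B ->
  \sum_(a in upper X) (-1) ^+ Defs.dim (order_complex (lower (upper X) a)) = 1%R :> int.
Proof.
move=> XL; have [e eR] := band_right_unit (@upperM _ _ X).
have [x0 x0X] := LambdaP _ XL.
have x0P : x0 \in upper X by rewrite mem_upper x0X.
have conn c (f : B -> int) : c \in upper X ->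
  (forall a b, a \in upper (supp c) -> b \in upper (supp c) -> (a <= b)%O -> f a = f b) ->
  forall a b, a \in upper (supp c) -> b \in upper (supp c) -> f a = f b.
  move=> _; apply: connected_constant; exact/connB/mem_Lambda.
have up a b : a \in upper X -> (supp a <= supp b)%O -> b \in upper X.
  by rewrite !mem_upper; apply: le_trans.
have e1 : \sum_(y in upper X) e y = 1.
  by rewrite -(eR x0 (fun=> 1) x0P); apply: eq_bigr => y _; rewrite mulr1.
have eup c : c \in upper X -> \sum_(y in upper X | (c <= y)%O) e y = 1.
  move=> cP; have := band_left_unit (@upperM _ _ X) conn up eR (fun z => (z == c)%:Z) cP.
  rewrite eqxx => H; apply: etrans H; rewrite big_mkcondr /=; apply: eq_bigr => y _.
  by rewrite lrb_leE; case: eqP; rewrite ?mulr1 ?mulr0.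
pose v a : int := (-1) ^+ Defs.dim (order_complex (lower (upper X) a)).
rewrite -/v.
transitivity (\sum_(a in upper X) \sum_(y in upper X | (a <= y)%O) e y * v a).
  by apply: eq_bigr => a aP; rewrite -mulr_suml eup ?mul1r.
rewrite (exchange_big_dep (mem (upper X))) /=; last by move=> a y _ /andP[].
apply: etrans e1; apply: eq_bigr => y yP; rewrite -mulr_sumr.
rewrite -[RHS]mulr1 -(CW_cell_euler (cwB XL) yP); congr (_ * _).
by apply: eq_bigl => a; move: yP; rewrite !inE => ->.
Qed.

End Euler.

(** * Rank *)

Section ComplexDimension.
Variable T : finType.
Implicit Types (K : {set {set T}}) (C D : {set T}).

Lemma dim_le K C : C \in K -> C != finset.set0 -> (#|C| <= (Defs.dim K).+1)%N.
Proof.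
move=> CK C0; have C1 : (0 < #|C|)%N by rewrite card_gt0.
have le : (#|C| <= \max_(D in K) #|D|)%N by apply: leq_bigmax_cond.
by rewrite /Defs.dim prednK // (leq_trans C1).
Qed.

Lemma dim_witness K C0 : C0 \in K -> C0 != finset.set0 ->
  exists2 C, C \in K & #|C| = (Defs.dim K).+1.
Proof.
move=> C0K C00; have [|C CK CE] := @eq_bigmax_cond _ (mem K) (fun C => #|C|).
  by rewrite card_gt0; apply/finset.set0Pn; exists C0.
exists C => //; rewrite /Defs.dim; move: CE => <-.
have C1 : (0 < #|C0|)%N by rewrite card_gt0.
by rewrite prednK // (leq_trans C1) //; apply: leq_bigmax_cond.
Qed.

Lemma dim_facet K C : C \in K -> C != finset.set0 ->
  #|C| = (Defs.dim K).+1 -> finset.set0 \notin K -> facet K C.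
Proof.
move=> CK C0 CE K0; apply/maxsetP; split=> // D DK CD.
apply/esym/eqP; rewrite eqEcard CD CE dim_le //.
by apply: contraNneq K0 => <-.
Qed.

Lemma pure_dim K C : pure K -> facet K C -> finset.set0 \notin K ->
  #|C| = (Defs.dim K).+1.
Proof.
move=> pK fC K0; have /maxsetP[CK _] := fC.
have nz D : D \in K -> D != finset.set0 by apply: contraTneq => ->.
have [D DK DE] := dim_witness CK (nz _ CK).
by rewrite -DE; apply: pK => //; apply: dim_facet; rewrite ?nz.
Qed.

End ComplexDimension.

Section Chains.
Variables (d : Order.disp_t) (T : finPOrderType d).
Implicit Types (P C D : {set T}) (x y : T).

Lemma chain_min C : is_chain C -> C != finset.set0 ->
  exists2 x, x \in C & forall y, y \in C -> (x <= y)%O.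
Proof.
move=> /chainP cC /finset.set0Pn[x0 x0C].
have [x xC xmin] := @arg_minnP _ x0 (mem C) (fun x => #|lower C x|) x0C.
exists x => // y yC; have /orP[//|yx] := cC _ _ xC yC.
have [->//|nyx] := eqVneq y x.
have /negP[] : ~~ (#|lower C x| <= #|lower C y|)%N; last exact: xmin.
rewrite -ltnNge; apply: proper_card; apply/properP; split.
  by apply/fintype.subsetP => z; rewrite !inE => /andP[-> /le_trans]; apply.
exists x; rewrite !inE ?lexx ?andbT //; apply/negP => /andP[_ xy].
by move: nyx; rewrite eq_le yx xy.
Qed.

Lemma chain_max C : is_chain C -> C != finset.set0 ->
  exists2 x, x \in C & forall y, y \in C -> (y <= x)%O.
Proof.
move=> /chainP cC /finset.set0Pn[x0 x0C].
have [x xC xmax] := @arg_maxnP _ x0 (mem C) (fun x => #|lower C x|) x0C.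
exists x => // y yC; have /orP[xy|//] := cC _ _ xC yC.
have [->//|nyx] := eqVneq y x.
have /negP[] : ~~ (#|lower C y| <= #|lower C x|)%N; last exact: xmax.
rewrite -ltnNge; apply: proper_card; apply/properP; split.
  by apply/fintype.subsetP => z; rewrite !inE => /andP[-> /le_trans]; apply.
exists y; rewrite !inE ?lexx ?andbT //; apply/negP => /andP[_ yx].
by move: nyx; rewrite eq_le yx xy.
Qed.

Lemma set0_order_complex P : finset.set0 \notin order_complex P.
Proof. by rewrite mem_order_complex eqxx !andbF. Qed.

Lemma chainU1 x C : is_chain C -> {in C, forall y, (x >=< y)%O} -> is_chain (x |: C).
Proof.
move=> /chainP cC xC; apply/chainP => y z; rewrite !inE.
move=> /orP[/eqP->|yC] /orP[/eqP->|zC].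
- exact: comparablexx.
- exact: xC.
- by rewrite comparable_sym xC.
- exact: cC.
Qed.

Lemma order_complex_neq0 P C : C \in order_complex P -> C != finset.set0.
Proof. by rewrite mem_order_complex => /and3P[]. Qed.

Lemma order_complex_lower_witness P x : x \in P ->
  exists2 C, C \in order_complex (lower P x) &
    #|C| = (Defs.dim (order_complex (lower P x))).+1.
Proof.
move=> xP; have [xL _] := lower_cone xP.
exact: dim_witness xL (order_complex_neq0 xL).
Qed.

End Chains.

Section BandRank.
Variables (d : Order.disp_t) (B : lrbType d).
Implicit Types (a b x y : B) (X Y : {set B}) (C : {set B}) (D : {set {set B}}).

Lemma supp_below a b Y : Y \in Lambda B -> (Y <= supp b)%O ->
  exists2 a, (a <= b)%O & supp a = Y.
Proof.
move=> /LambdaP[y ->] yb; exists (b * y)%g; first exact: mul_le.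
by rewrite suppM; apply/meet_idPr.
Qed.

Lemma supp_inj_chain C : is_chain C -> {in C &, injective (@supp d B)}.
Proof.
move=> /chainP cC x y xC yC E; have /orP[le|le] := cC _ _ xC yC.
  exact: supp_inj_le.
by apply/esym/supp_inj_le.
Qed.

(** Lifting goes from the top: the largest support is realized below [b], the others below that
    element. *)
Lemma chain_lift b D : is_chain D -> D \subset lower (Lambda B) (supp b) ->
  exists C, [/\ is_chain C, C \subset lower [set: B]%SET b & (@supp d B @: C)%SET = D].
Proof.
elim: {D}#|D| {-2}D b (leqnn #|D|) => [|n IH] D b Dn cD Db.
  exists finset.set0; split; first by apply/chainP => x y; rewrite inE.
    exact: finset.sub0set.
  by rewrite finset.imset0; apply/esym/eqP; rewrite -cards_eq0 -leqn0.
have [D0|D0] := eqVneq D finset.set0.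
  by apply: IH; rewrite ?D0 ?cards0 // -?D0.
have [Y YD Ymax] := chain_max cD D0.
have := fintype.subsetP Db _ YD; rewrite inE => /andP[YL Yb].
have [a ab aY] := supp_below b YL Yb.
have [||| C [cC CL CE]] := IH (D :\ Y) a.
- by move: Dn; rewrite (cardsD1 Y) YD.
- by apply: chainS cD; apply: finset.subsetDl.
- apply/fintype.subsetP => Z; rewrite !inE => /andP[_ ZD].
  have := fintype.subsetP Db _ ZD; rewrite inE => /andP[-> _] /=.
  by rewrite aY Ymax.
exists (a |: C); split.
- apply: chainU1 => // y /(fintype.subsetP CL); rewrite !inE => /= ya.
  by rewrite /Order.comparable ya orbT.
- apply/fintype.subsetP => y; rewrite !inE => /orP[/eqP->//|].
  by move=> /(fintype.subsetP CL); rewrite !inE => /le_trans; apply.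
- by rewrite finset.imsetU1 CE aY finset.setD1K.
Qed.

(** Support is injective on chains, and chains of supports lift. *)
Lemma dim_lower_supp b :
  Defs.dim (order_complex (lower [set: B]%SET b)) = dim_supp (supp b).
Proof.
have bT : b \in [set: B]%SET by rewrite inE.
apply/eqP; rewrite -eqSS eqn_leq; apply/andP; split.
  have [C CK <-] := order_complex_lower_witness bT.
  have := CK; rewrite mem_order_complex => /and3P[Cb cC C0].
  rewrite -(card_in_imset (supp_inj_chain cC)); apply: dim_le; last first.
    by have [x xC] := finset.set0Pn _ C0; apply/finset.set0Pn; exists (supp x); apply: imset_f.
  rewrite mem_order_complex; apply/and3P; split.
  - apply/fintype.subsetP => _ /imsetP[x xC ->]; rewrite inE mem_Lambda /=.
    by apply: supp_homo; have := fintype.subsetP Cb _ xC; rewrite inE => /andP[].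
  - apply/chainP => _ _ /imsetP[x xC ->] /imsetP[y yC ->].
    have /chainP/(_ _ _ xC yC)/orP[le|le] := cC; rewrite /Order.comparable.
      by rewrite supp_homo.
    by rewrite orbC supp_homo.
  - by have [x xC] := finset.set0Pn _ C0; apply/finset.set0Pn; exists (supp x); apply: imset_f.
have [D DK <-] := order_complex_lower_witness (mem_Lambda b).
have := DK; rewrite mem_order_complex => /and3P[Db cD D0].
have [C [cC CL CE]] := chain_lift cD Db.
rewrite -CE; apply: leq_trans (leq_imset_card _ _) _.
have C0 : C != finset.set0 by apply: contraNneq D0 => C0; rewrite -CE C0 finset.imset0.
by apply: dim_le; rewrite // mem_order_complex CL cC.
Qed.

(** A longest chain below [b] in [upper X], prolonged by a longest chain below its least element, is
    a maximal chain of the band below [b]; gradedness gives its size. *)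
Lemma dim_upper X b : graded [set: B]%SET -> X \in Lambda B -> b \in upper X ->
  (dim_supp X + Defs.dim (order_complex (lower (upper X) b)) = dim_supp (supp b))%N.
Proof.
move=> gr XL bX; have [C2 C2K C2E] := order_complex_lower_witness bX.
have := C2K; rewrite mem_order_complex => /and3P[C2b cC2 C20].
have [a aC2 amin] := chain_min cC2 C20.
have aL := fintype.subsetP C2b _ aC2.
have [aX ab] : a \in upper X /\ (a <= b)%O by move: aL; rewrite !inE => /andP[].
have C2max x : x \in upper X -> (x <= b)%O -> {in C2, forall y, (x >=< y)%O} -> x \in C2.
  move=> xX xb xC2; apply: contraT => nx.
  have : (#|x |: C2| <= #|C2|)%N; last by rewrite cardsU1 nx ltnn.
  rewrite C2E; apply: dim_le; last by apply/finset.set0Pn; exists x; rewrite !inE eqxx.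
  rewrite mem_order_complex; apply/and3P; split.
  - by rewrite finset.subUset finset.sub1set C2b andbT inE xX.
  - exact: chainU1.
  - by apply/finset.set0Pn; exists x; rewrite !inE eqxx.
(* Otherwise an element of support [X] below [a] would lengthen [C2]. *)
have aE : supp a = X.
  have Xa : (X <= supp a)%O by rewrite -mem_upper.
  have [a' a'a a'X] := supp_below a XL Xa.
  have a'C2 : a' \in C2.
    apply: C2max; first by rewrite mem_upper a'X.
      exact: le_trans a'a ab.
    by move=> y /amin ay; rewrite /Order.comparable (le_trans a'a ay).
  by have := amin _ a'C2 => aa'; rewrite -a'X; congr supp; apply: le_anti; rewrite aa'.
have aT : a \in [set: B]%SET by rewrite inE.
have bT : b \in [set: B]%SET by rewrite inE.
have [C1 C1K C1E] := order_complex_lower_witness aT.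
have := C1K; rewrite mem_order_complex => /and3P[C1a cC1 C10].
have C1le x : x \in C1 -> (x <= a)%O.
  by move=> /(fintype.subsetP C1a); rewrite inE => /andP[].
have C1max x : (x <= a)%O -> {in C1, forall y, (x >=< y)%O} -> x \in C1.
  move=> xa xC1; apply: contraT => nx.
  have : (#|x |: C1| <= #|C1|)%N; last by rewrite cardsU1 nx ltnn.
  rewrite C1E; apply: dim_le; last by apply/finset.set0Pn; exists x; rewrite !inE eqxx.
  rewrite mem_order_complex; apply/and3P; split.
  - by rewrite finset.subUset finset.sub1set C1a andbT !inE.
  - exact: chainU1.
  - by apply/finset.set0Pn; exists x; rewrite !inE eqxx.
have aC1 : a \in C1.
  by apply: C1max => // y /C1le ya; rewrite /Order.comparable ya orbT.
have C2X x : x \in C2 -> x \in upper X /\ (x <= b)%O.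
  by move=> /(fintype.subsetP C2b); rewrite !inE => /andP[].
pose C := C1 :|: C2.
have CK : C \in order_complex (lower [set: B]%SET b).
  rewrite mem_order_complex; apply/and3P; split.
  - apply/fintype.subsetP => x; rewrite !inE => /orP[/C1le xa|/C2X[]//].
    exact: le_trans xa ab.
  - apply/chainP => x y; rewrite !finset.in_setU => /orP[x1|x2] /orP[y1|y2].
    + by have /chainP := cC1; apply.
    + by rewrite /Order.comparable (le_trans (C1le _ x1)) // amin.
    + by rewrite /Order.comparable orbC (le_trans (C1le _ y1)) // amin.
    + by have /chainP := cC2; apply.
  - by apply/finset.set0Pn; exists a; rewrite finset.in_setU aC1.
have fC : facet (order_complex (lower [set: B]%SET b)) C.
  apply/maxsetP; split=> // D DK /fintype.subsetP CD.
  have : D \in order_complex (lower [set: B]%SET b) := DK.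
  rewrite mem_order_complex => /and3P[/fintype.subsetP Db /chainP cD _].
  apply/eqP; rewrite finset.eqEsubset andbC; apply/andP; split.
    exact/fintype.subsetP.
  have C1D y : y \in C1 -> y \in D by move=> y1; apply: CD; rewrite finset.in_setU y1.
  have C2D y : y \in C2 -> y \in D by move=> y1; apply: CD; rewrite finset.in_setU y1 orbT.
  apply/fintype.subsetP => x xD; rewrite finset.in_setU.
  have /orP[xa|ax] := cD _ _ xD (C1D _ aC1).
    by rewrite C1max // => y /C1D; apply: cD.
  rewrite orbC C2max //.
  - by rewrite mem_upper -aE supp_homo.
  - by have := Db _ xD; rewrite !inE.
  - by move=> y /C2D; apply: cD.
have CE := pure_dim (gr b bT) fC (set0_order_complex _).
have CI : C1 :&: C2 = [set a]%SET.
  apply/setP => x; rewrite finset.in_setI finset.in_set1.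
  apply/andP/eqP => [[/C1le xa /amin ax]|->]; last by split.
  by apply: le_anti; rewrite xa ax.
(* Dimensions are cardinals minus one, so the one shared element [a] makes them add up exactly. *)
have := cardsUI C1 C2; rewrite CI cards1 -/C CE C1E C2E.
by rewrite !dim_lower_supp aE addn1 addSn addnS => -[].
Qed.

End BandRank.

(** * Moebius numbers *)

Lemma sum_mobius (d : Order.disp_t) (T : finPOrderType d) (P : {set T}) x y :
  x \in P -> y \in P ->
  \sum_(z in P | (x <= z <= y)%O) mobius P x z = (x == y)%:Z.
Proof.
move=> xP yP; have [<-|xy] := eqVneq x y.
  rewrite (big_pred1 x) ?mobiusE ?eqxx // => z /=.
  case: eqVneq => [->|zx]; first by rewrite xP lexx.
  by rewrite -eq_le eq_sym (negbTE zx) andbF.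
have [le_xy|nle] := boolP (x <= y)%O; last first.
  by rewrite big1 // => z /andP[_ /andP[xz /(le_trans xz)]]; rewrite (negbTE nle).
rewrite (bigD1 y) /=; last by rewrite yP le_xy lexx.
rewrite [mobius P x y]mobiusE // (negbTE xy) addrC; apply/eqP; rewrite subr_eq0.
apply/eqP/eq_bigl => z; rewrite -!andbA; congr [&& _, _ & _].
by rewrite lt_neqAle andbC.
Qed.

(** In a full-rank factorization [G = c r], idempotence forces [r c = 1]. *)
Lemma mxtrace_idempotent (F : fieldType) n (G : 'M[F]_n) :
  G *m G = G -> \tr G = (\rank G)%:R.
Proof.
move: (row_base G) (col_base G) (row_base_free G) (col_base_full G) (mulmx_base G).
move=> r c r_free /row_fullP[l lc] GE GG.
suff rc : r *m c = 1%:M by rewrite -{1}GE mxtrace_mulC rc mxtrace1.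
apply: (row_free_inj r_free); rewrite mul1mx.
have : l *m (c *m r *m (c *m r)) = l *m (c *m r) by rewrite GE GG.
by rewrite !mulmxA lc !mul1mx.
Qed.

Section BandCounting.
Variables (R : realType) (d : Order.disp_t) (B : lrbType d).
Hypotheses (connB : connected_lrb B R) (cwB : CW_lrb B R).
Implicit Types (a b x y : B) (U V W X Y : {set B}).

Let sgn X : int := (-1) ^+ dim_supp X.

Let sgnK X : sgn X * sgn X = 1%R.
Proof. by rewrite -expr2 sqrr_sign. Qed.

Let gradedB : graded [set: B]%SET.
Proof.
have [h0 hmin] := hat0P B.
suff <- : upper (hat0 B) = [set: B]%SET by case: (cwB h0).
by apply/setP => b; rewrite mem_upper inE hmin // mem_Lambda.
Qed.

Let sgn_dim X b : X \in Lambda B -> b \in upper X ->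
  (-1) ^+ Defs.dim (order_complex (lower (upper X) b)) = (sgn X * sgn (supp b))%R.
Proof.
move=> XL bX; rewrite /sgn -(dim_upper gradedB XL bX) exprD mulrA.
by rewrite -/(sgn X) sgnK mul1r.
Qed.

Let sgn_cell X b : X \in Lambda B -> b \in upper X ->
  \sum_(a in lower (upper X) b) sgn (supp a) = sgn X.
Proof.
move=> XL bX; have := CW_cell_euler (cwB XL) bX.
under eq_bigr => a aL.
  rewrite sgn_dim //; last by move: aL; rewrite !inE => /andP[].
  over.
by rewrite -mulr_sumr => /(congr1 (fun z => sgn X * z)); rewrite mulrA sgnK mul1r mulr1.
Qed.

Let sgn_total X : X \in Lambda B ->
  \sum_(a in upper X) sgn (supp a) = sgn X.
Proof.
move=> XL; have := band_euler connB cwB XL.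
under eq_bigr => a aL do rewrite sgn_dim //.
by rewrite -mulr_sumr => /(congr1 (fun z => sgn X * z)); rewrite mulrA sgnK mul1r mulr1.
Qed.

Let smobius X W : int := sgn X * sgn W * mobius (Lambda B) X W.

(** Moebius inversion of the Euler relation; [D] lets it serve both for the whole band and inside
    one closed cell. *)
Let count_supp_mobius (Q : {set B}) (D : pred {set B}) X : X \in Lambda B ->
  (forall a U, a \in Q -> (U <= supp a)%O -> D U) ->
  (forall U, U \in Lambda B -> (X <= U)%O -> D U ->
     \sum_(a in Q | (U <= supp a)%O) sgn (supp a) = sgn U) ->
  \sum_(W in Lambda B | (X <= W)%O && D W) smobius X W =
    #|[set a in Q | supp a == X]%SET|%:Z.
Proof.
move=> XL QD DE.
transitivity (\sum_(W in Lambda B | (X <= W)%O && D W)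
  \sum_(a in Q | (W <= supp a)%O) sgn X * sgn (supp a) * mobius (Lambda B) X W).
  apply: eq_bigr => W /andP[WL /andP[XW DW]].
  by rewrite /smobius -(DE W) // mulr_sumr mulr_suml.
rewrite (exchange_big_dep (mem Q)) /=; last by move=> W a _ /andP[].
transitivity (\sum_(a in Q) (supp a == X)%:Z).
  apply: eq_bigr => a aQ; rewrite -mulr_sumr.
  transitivity (sgn X * sgn (supp a) * (X == supp a)%:Z).
    congr (_ * _); rewrite -(sum_mobius XL (mem_Lambda a)); apply: eq_bigl => W.
    rewrite aQ /= -!andbA; congr (_ && _); congr (_ && _).
    by apply: andb_idl => /(QD _ _ aQ).
  by rewrite eq_sym; case: eqP => [->|_]; rewrite ?sgnK ?mulr0 ?mulr1.
rewrite -sum1_card (big_morph Posz PoszD (erefl _)) /=.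
rewrite [RHS](eq_bigl (fun a => (a \in Q) && (supp a == X))); last first.
  by move=> a; rewrite inE.
by rewrite [RHS]big_mkcondr; apply: eq_bigr => a _; case: eqP.
Qed.

Let count_cell X y : X \in Lambda B ->
  \sum_(V in Lambda B | (X <= V)%O && (V <= supp y)%O) smobius X V =
    #|[set a in lower [set: B]%SET y | supp a == X]%SET|%:Z.
Proof.
move=> XL; apply: (count_supp_mobius (D := fun V => (V <= supp y)%O)) => //.
  move=> a U; rewrite !inE => /= ay Ua; exact: le_trans Ua (supp_homo ay).
move=> U UL XU Uy; rewrite -(sgn_cell UL (b := y)) ?mem_upper //.
by apply: eq_bigl => a; rewrite !inE andbC.
Qed.

(* The signed Moebius number is the trace of the primitive idempotent [G] of
   the cell below [b] acting on the vertices of that cell of support [X]. *)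
Let smobius_ge0 X W : X \in Lambda B -> W \in Lambda B -> (X <= W)%O ->
  0 <= smobius X W.
Proof.
move=> XL /LambdaP[b ->] Xb.
pose S := strict_lower (upper X) b.
have SP x : (x \in S) = (X <= supp x)%O && (x < b)%O by rewrite !inE.
have SM x y : x \in S -> y \in S -> (x * y)%g \in S.
  rewrite !SP => /andP[Xx xb] /andP[Xy _].
  by rewrite suppM lexI Xx Xy (le_lt_trans (mul_le x y) xb).
have [e eR] := band_right_unit SM.
pose A a := (a <= b)%O && (supp a == X).
pose n := #|{: B}|.
(* Left multiplication by [y] on the elements of support [X] below [b], padded with zero rows; in
   the row convention products are reversed. *)
pose M y : 'M[rat]_n := \matrix_(i, j)
  (A (enum_val i) && ((y * enum_val i)%g == enum_val j))%:R.
pose L y := (X <= supp y)%O && (y <= b)%O.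
have SL y : y \in S -> L y by rewrite SP /L => /andP[-> /ltW].
have Lb : L b by rewrite /L Xb lexx.
have MM x y : L x -> M x *m M y = M (y * x)%g.
  move=> /andP[Xx xb]; apply/matrixP => i j; rewrite !mxE.
  set a := enum_val i; case aA: (A a); last first.
    by rewrite big1 // => k _; rewrite !mxE -/a aA mul0r.
  have xaA : A (x * a)%g.
    have /andP[_ /eqP aX] := aA.
    rewrite /A suppM aX (le_trans (mul_le x a) xb) /=.
    by apply/eqP/meet_idPr.
  rewrite (bigD1 (enum_rank (x * a)%g)) //= !mxE !enum_rankK -/a aA xaA eqxx mul1r.
  rewrite mulgA big1 ?addr0 // => k kx; rewrite !mxE -/a aA /=.
  case: eqP => [xak|_]; last by rewrite mul0r.
  by rewrite xak enum_valK eqxx in kx.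
have yb y : L y -> (y * b)%g = y /\ (b * y)%g = y.
  move=> /andP[_ /leP_mul byE]; split=> //.
  by rewrite -{1}byE lrb_regular.
pose E := \sum_(y in S) (e y)%:~R *: M y.
have ME x : x \in S -> \sum_(y in S) (e y)%:~R *: M (x * y)%g = M x.
  move=> xS; apply/matrixP => i j; rewrite summxE mxE.
  have := eR x (fun z => (A (enum_val i) && ((z * enum_val i)%g == enum_val j))%:Z) xS.
  move=> /(congr1 (fun z : int => z%:~R : rat)) H; apply: etrans H.
  by rewrite rmorph_sum /=; apply: eq_bigr => y _; rewrite !mxE intrM.
have EE : E *m E = E.
  rewrite {1 2}/E mulmx_sumr.
  under eq_bigr => x xS.
    rewrite mulmx_suml; under eq_bigr => y yS do
      rewrite -scalemxAl -scalemxAr MM ?SL // scalerA mulrC -scalerA.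
    rewrite -scaler_sumr ME //.
  over.
  by [].
have bE : M b *m E = E.
  rewrite /E mulmx_sumr; apply: eq_bigr => y yS.
  by rewrite -scalemxAr MM // (yb _ (SL _ yS)).1.
have Eb : E *m M b = E.
  rewrite /E mulmx_suml; apply: eq_bigr => y yS.
  by rewrite -scalemxAl MM ?SL // (yb _ (SL _ yS)).2.
pose G := M b - E.
have GG : G *m G = G.
  by rewrite /G mulmxBl !mulmxBr MM // lrb_idem bE Eb EE subrr subr0.
pose N y := #|[set a in lower [set: B]%SET y | supp a == X]%SET|.
(* The trace counts fixed elements, and [y * a = a] means [a <= y]. *)
have trM y : L y -> \tr (M y) = (N y)%:R.
  move=> /andP[_ y_le]; rewrite /mxtrace.
  rewrite (reindex_onto (@enum_rank B) enum_val) /=; last by move=> i _; rewrite enum_valK.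
  under eq_bigr => a _ do rewrite mxE enum_rankK -lrb_leE.
  under eq_bigl => a do rewrite enum_rankK eqxx.
  rewrite /N -sum1_card natr_sum big_mkcond /= [RHS]big_mkcond /=.
  apply: eq_bigr => a _; rewrite !inE /A.
  case ay: (a <= y)%O; rewrite ?andbF //= (le_trans ay) //= andbT.
  by case: eqP.
have trG : \tr G = ((N b)%:Z - \sum_(y in S) e y * (N y)%:Z)%:~R.
  rewrite /G linearB /= trM // rmorphB /=; congr (_ - _).
  rewrite /E linear_sum rmorph_sum /=; apply: eq_bigr => y yS.
  by rewrite linearZ /= trM ?SL // intrM.
have : 0 <= \tr G by rewrite mxtrace_idempotent // ler0n.
rewrite trG ler0z; apply: etrans; congr (0 <= _).
have NE y : L y -> (N y)%:Z = \sum_(V in Lambda B | (X <= V)%O && (V <= supp b)%O)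
    smobius X V * (V <= supp y)%O%:Z.
  move=> /andP[_ /supp_homo y_le]; rewrite -count_cell //.
  rewrite big_mkcond [RHS]big_mkcond /=; apply: eq_bigr => V _.
  case VL: (V \in Lambda B) => //=; case XV: (X <= V)%O => //=.
  case Vy: (V <= supp y)%O; rewrite ?mulr1 ?mulr0 ?if_same //.
  by rewrite (le_trans Vy).
rewrite NE // (eq_bigr (fun y => \sum_(V in Lambda B | (X <= V)%O && (V <= supp b)%O)
    smobius X V * (e y * (V <= supp y)%O%:Z))); last first.
  move=> y yS; rewrite NE ?SL // mulr_sumr; apply: eq_bigr => V _.
  by rewrite mulrCA.
rewrite exchange_big /=; under [X in _ - X]eq_bigr do rewrite -mulr_sumr.
have bP : [&& supp b \in Lambda B, (X <= supp b)%O & (supp b <= supp b)%O].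
  by rewrite mem_Lambda Xb lexx.
rewrite (bigD1 (supp b)) //= [X in _ - X](bigD1 (supp b)) //= lexx mulr1.
rewrite [X in smobius _ _ * X]big1 ?mulr0 ?add0r; last first.
  move=> y; rewrite SP => /andP[_ /supp_homo_lt y_lt].
  by rewrite lt_geF // mulr0.
rewrite -addrA -sumrB big1 ?addr0 // => V /andP[/and3P[VL XV Vb] nVb].
have [x xb xV] := supp_below b VL Vb.
have xS : x \in S.
  rewrite SP xV XV lt_neqAle xb andbT /=.
  by apply: contraNneq nVb => <-; rewrite xV.
(* Tested at an [x] of support [V] strictly below [b], the right unit has coefficient sum 1 over the
   [y] with [V <= supp y]; hence every term but that of [supp b] cancels. *)
have := eR x (fun z => (V <= supp z)%O%:Z) xS; rewrite xV lexx => eV.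
rewrite Vb mulr1; apply/eqP; rewrite subr_eq0 -[X in X == _]mulr1.
apply/eqP; congr (_ * _); apply: esym; apply: etrans eV; apply: eq_bigr => y _.
by rewrite suppM xV lexI lexx.
Qed.

Lemma count_supp X : X \in Lambda B ->
  (#|[set b : B | supp b == X]%SET|)%:Z
    = \sum_(Y in Lambda B | (X <= Y)%O) `|mobius (Lambda B) X Y|.
Proof.
move=> XL.
have := @count_supp_mobius [set: B]%SET predT X XL (fun _ _ _ _ => isT).
have -> : [set a in [set: B]%SET | supp a == X]%SET = [set b : B | supp b == X]%SET.
  by apply/setP => b; rewrite !inE.
move=> <- => [|U UL _ _]; last first.
  by rewrite -(sgn_total UL); apply: eq_bigl => a; rewrite !inE.
apply: eq_big => [Y|Y /andP[YL /andP[XY _]]]; first by rewrite andbT.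
rewrite -[LHS]ger0_norm ?smobius_ge0 // /smobius !normrM.
by rewrite !normrX normrN normr1 !expr1n !mul1r.
Qed.

End BandCounting.

(** * Cells of the band and its minimal ideal *)

Section CellCounting.
Variables (d : Order.disp_t) (B : lrbType d).
Implicit Types (a b x y : B) (X Y : {set B}).

Lemma order_complex_lower_inj :
  injective (fun b => order_complex (lower [set: B]%SET b)).
Proof.
have le a b : order_complex (lower [set: B]%SET a) = order_complex (lower [set: B]%SET b) ->
    (a <= b)%O.
  have [aL _] := @lower_cone _ _ [set: B]%SET a (finset.in_setT a).
  move=> E; move: aL; rewrite E mem_order_complex => /and3P[+ _ _].
  by rewrite finset.sub1set !inE.
by move=> a b E; apply: le_anti; rewrite !le.
Qed.

Lemma f_vectorE k : f_vector [set: B]%SET k = #|[set b : B | dim_supp (supp b) == k]%SET|.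
Proof.
rewrite /f_vector -(card_imset _ order_complex_lower_inj); apply: eq_card => c.
rewrite inE; apply/andP/imsetP => [[/imsetP[b _ ->]]|[b + ->]].
  by rewrite dim_lower_supp => bk; exists b => //; rewrite inE.
by rewrite inE dim_lower_supp => bk; split=> //; apply: imset_f; rewrite inE.
Qed.

Lemma dim_supp_eq0 X : X \in Lambda B -> (dim_supp X == 0%N) = (X == hat0 B).
Proof.
move=> XL; have [hL hmin] := hat0P B.
apply/eqP/eqP => [d0|->].
  apply/eqP; apply: contraT => nX.
  have : (#|[set X; hat0 B]%SET| <= 1)%N; last by rewrite cards2 nX.
  rewrite -[1%N]/(0.+1) -d0; apply: dim_le; last first.
    by apply/finset.set0Pn; exists X; rewrite !inE eqxx.
  rewrite mem_order_complex; apply/and3P; split.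
  - by rewrite finset.subUset !finset.sub1set !inE XL hL lexx hmin.
  - apply: chainU1; first by apply/chainP => x y; rewrite !inE => /eqP-> /eqP->; apply: comparablexx.
    by move=> y; rewrite inE => /eqP->; rewrite /Order.comparable hmin ?orbT.
  - by apply/finset.set0Pn; exists X; rewrite !inE eqxx.
have [C CK CE] := order_complex_lower_witness hL.
apply/eqP; rewrite -leqn0 -ltnS -CE -(cards1 (hat0 B)); apply: subset_leq_card.
move: CK; rewrite mem_order_complex => /and3P[/fintype.subsetP Ch _ _].
apply/fintype.subsetP => Y /Ch; rewrite !inE => /andP[YL Yh].
by rewrite eq_le Yh hmin.
Qed.

(** If [supp b] is least then [b * a = b] for all [a], so [b] lies in every ideal; and such elements
    form an ideal. *)
Lemma minimal_idealE : minimal_ideal B = [set b : B | supp b == hat0 B]%SET.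
Proof.
have [hL hmin] := hat0P B.
have [h hE] := LambdaP _ hL.
apply/setP => b; apply/bigcapP/idP => [bI|bh I].
  apply: bI; apply/andP; split; first by apply/finset.set0Pn; exists h; rewrite inE hE.
  apply/forallP => x; apply/forallP => y; apply/implyP; rewrite !inE !suppM => /eqP->.
  have hy : (hat0 B `&` supp y)%O = hat0 B by apply/meet_idPl/hmin/mem_Lambda.
  by rewrite [(supp y `&` _)%O]meetC hy eqxx.
move=> /andP[/finset.set0Pn[a aI] /forallP/(_ a)/forallP/(_ b)/implyP/(_ aI)/andP[_]].
suff -> : (b * a)%g = b by [].
by apply/supp_leP; move: bh; rewrite inE => /eqP->; apply: hmin; apply: mem_Lambda.
Qed.

End CellCounting.

Theorem theorem9p3 (R : realType) (d : Order.disp_t) (B : lrbType d)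
    (connB : connected_lrb B R) (cwB : CW_lrb B R) :
  [/\ forall X : {set B}, X \in Lambda B ->
        (#|[set b : B | supp b == X]%SET|)%:Z
          = \sum_(Y in Lambda B | (X <= Y)%O) `|mobius (Lambda B) X Y|,
      #|minimal_ideal B| = f_vector [set: B]%SET 0,
      (f_vector [set: B]%SET 0)%:Z
          = \sum_(X in Lambda B) `|mobius (Lambda B) (hat0 B) X|
    & forall k : nat,
        (f_vector [set: B]%SET k)%:Z
          = \sum_(X in Lambda B | dim_supp X == k)
              \sum_(Y in Lambda B | (X <= Y)%O) `|mobius (Lambda B) X Y|].
Proof.
have [hL hmin] := hat0P B.
have f0E : f_vector [set: B]%SET 0 = #|[set b : B | supp b == hat0 B]%SET|.
  rewrite f_vectorE; apply: eq_card => b.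
  by rewrite !inE dim_supp_eq0 ?mem_Lambda.
split.
- exact: (count_supp connB cwB).
- by rewrite minimal_idealE f0E.
- rewrite f0E (count_supp connB cwB hL); apply: eq_bigl => X.
  by case XL: (X \in Lambda B) => //=; rewrite hmin.
- move=> k; rewrite f_vectorE.
  rewrite -sum1_card (partition_big (@supp d B) (fun X => (X \in Lambda B) && (dim_supp X == k))).
    rewrite (big_morph Posz PoszD (erefl _)); apply: eq_bigr => X /andP[XL dX].
    rewrite -(count_supp connB cwB XL) -sum1_card; congr Posz.
    apply: eq_bigl => b; rewrite !inE.
    by case: (supp b =P X) => [->|_]; rewrite ?dX ?andbF.
  by move=> b; rewrite inE mem_Lambda.
Qed.
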